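(* Let $\Gamma=\Lambda$, and let $\mathbb{P}$ be the forcing poset whose conditions are pairs $(f,A)$ satisfying: (1) $f$ is a finite partial function from $\omega_2$ to $\omega_2$; (2) $A$ is a finite adequate set; (3) for all $M\in A$ and $\alpha\in\mathrm{dom}(f)$, if $M\cap[\alpha,f(\alpha)]\neq\emptyset$, then $\alpha\in M$ and $f(\alpha)\in M$; ordered by $(g,B)\le(f,A)$ iff $A\subseteq B$ and $f\subseteq g$. Then $\mathbb{P}$ preserves $\omega_2$.
   Context: Standing assumptions and notation. Assume $2^{\omega_1}=\omega_2$ and fix a bijection $\pi:\omega_2\to H(\omega_2)$. $P_{\omega_1}(\omega_2)$ is the set of countable subsets of $\omega_2$. Assume there is a stationary set $\mathcal{Y}\subseteq P_{\omega_1}(\omega_2)$ which is thin, i.e. for all $\beta<\omega_2$ the set $\{a\cap\beta: a\in\mathcal{Y}\}$ has size at most $\omega_1$; fix such a $\mathcal{Y}$ which is moreover closed under initial segments ($a\in\mathcal{Y}$, $\beta<\omega_2$ imply $a\cap\beta\in\mathcal{Y}$). Let $\mathcal{A}$ be the structure $(H(\omega_2),\in,\pi,\mathcal{Y})$, which has definable Skolem functions (via the well-ordering induced by $\pi$). For $a\subseteq H(\omega_2)$, $Sk(a)$ is the closure of $a$ under a fixed set of definable Skolem functions for $\mathcal{A}$. Let $C$ be the (club) set of $\beta<\omega_2$ with $Sk(\beta)\cap\omega_2=\beta$, and let $\Lambda$ be the set of $\beta<\omega_2$ of cofinality $\omega_1$ which are limit points of $C$. Let $\mathcal{X}$ be the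 set of $M\in\mathcal{Y}$ such that $Sk(M)\cap\omega_2=M$ and for all $\gamma\in M$, $\sup(C\cap\gamma)\in M$. Comparison points and adequacy. $\Gamma\subseteq\Lambda$ is a fixed stationary subset of $\omega_2$; here $\Gamma=\Lambda$. For $M\in\mathcal{X}$, $\Gamma_M$ is the set of $\beta\in\Gamma$ such that $\beta=\min(\Gamma\setminus\sup(M\cap\beta))$, i.e. $\Gamma\cap[\sup(M\cap\beta),\beta)=\emptyset$. For $M,N\in\mathcal{X}$, $\Gamma_M\cap\Gamma_N$ has a largest element, denoted $\beta_{M,N}$. A set $A\subseteq\mathcal{X}$ is adequate if for all $M,N\in A$, either $M\cap\beta_{M,N}=N\cap\beta_{M,N}$, or $M\cap\beta_{M,N}\in Sk(N)$, or $N\cap\beta_{M,N}\in Sk(M)$. For ordinals $\alpha,\beta$, $[\alpha,\beta]$ denotes the closed interval between the smaller and the larger of the two. *)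

(* Defs.v *)
From HB Require Import structures.
From Stdlib Require Import Relation_Operators.
From mathcomp Require Import all_boot.
From mathcomp Require Import boolp classical_sets functions cardinality.

Set Implicit Arguments.
Unset Strict Implicit.
Unset Printing Implicit Defensive.

Local Open Scope classical_set_scope.
Local Open Scope card_scope.
Local Open Scope quotient_scope.

(* The set-theoretic universe is Aczel's type of well-founded trees branching
   over small types, quotiented by bisimulation.  Under the classical axioms of
   boolp, the quotient V is a model of (second-order) ZFC.  The universe of
   small types is named so that sets and names for sets (below) range over
   families of the same size. *)
Definition small := Type.

Inductive tree : Type := Tree (A : small) (f : A -> tree).

Definition branch (t : tree) : small := match t with Tree A _ => A end.
Definition child (t : tree) : branch t -> tree :=
  match t with Tree _ f => f end.

Fixpoint bisim (t u : tree) : Prop :=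
  match t, u with
  | Tree A f, Tree B g => (forall i, exists j, bisim (f i) (g j)) /\
                          (forall j, exists i, bisim (f i) (g j))
  end.

Lemma bisim_refl t : bisim t t.
Proof. by elim: t => A f IH /=; split=> i; exists i; apply: IH. Qed.

Lemma bisim_sym t u : bisim t u -> bisim u t.
Proof.
elim: t u => A f IH [B g] /= [fg gf].
by split=> [j|i]; [have [i /IH] := gf j; exists i | have [j /IH] := fg i; exists j].
Qed.

Lemma bisim_trans t u v : bisim t u -> bisim u v -> bisim t v.
Proof.
elim: t u v => A f IH [B g] [C h] /= [fg gf] [gh hg]; split=> [i|k].
  by have [j /IH fgj] := fg i; have [k /fgj] := gh j; exists k.
by have [j gk] := hg k; have [i /IH/(_ gk)] := gf j; exists i.
Qed.

HB.instance Definition _ := gen_eqMixin tree.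
HB.instance Definition _ := gen_choiceMixin tree.

Definition bisimb (t u : tree) : bool := `[< bisim t u >].

Lemma bisimb_refl : reflexive bisimb.
Proof. by move=> t; apply/asboolP/bisim_refl. Qed.

Lemma bisimb_sym : symmetric bisimb.
Proof. by move=> t u; apply/asboolP/asboolP; apply: bisim_sym. Qed.

Lemma bisimb_trans : transitive bisimb.
Proof.
by move=> u t v /asboolP tu /asboolP uv; apply/asboolP; apply: bisim_trans uv.
Qed.

Canonical bisim_equiv := EquivRel bisimb bisimb_refl bisimb_sym bisimb_trans.

Definition V := {eq_quot bisim_equiv}.
HB.instance Definition _ := Choice.on V.

Definition vmem (x y : V) : Prop :=
  exists i : branch (repr y), x = \pi_V (child i).

Definition elts (y : V) : set V := [set x | vmem x y].

Definition empty : V := \pi_V (Tree (fun v : False => match v with end)).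

(* The set with extension S; meaningful when S is not a proper class. *)
Definition mkset (S : set V) : V := xget empty [set v | elts v = S].

Definition vsub (a b : V) : Prop := elts a `<=` elts b.
Definition vinter (a b : V) : V := mkset (elts a `&` elts b).
Definition vpow (a : V) : set V := [set x | vsub x a].

(* By foundation, a transitive set of transitive sets is a von Neumann
   ordinal. *)
Definition transitive_set (x : V) : Prop := forall y, vmem y x -> vsub y x.
Definition ordinal (x : V) : Prop :=
  transitive_set x /\ forall y, vmem y x -> transitive_set y.

Definition ole (a b : V) : Prop := vmem a b \/ a = b.

(* The supremum of a set of ordinals is its union. *)
Definition osup (S : set V) : V :=
  mkset [set x | exists2 y, S y & vmem x y].

Definition omega1 : V := xget empty
  [set a | [/\ ordinal a, ~ countable (elts a)
             & forall b, vmem b a -> countable (elts b)]].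

Definition omega2 : V := xget empty
  [set a | [/\ ordinal a, ~ (elts a #<= elts omega1)
             & forall b, vmem b a -> elts b #<= elts omega1]].

Definition trcl (x : V) : set V := [set y | clos_trans V vmem y x].

Definition H_omega2 : set V := [set x | ~ (elts omega2 #<= trcl x)].

Definition cofinal_map (f : V -> V) (a b : V) : Prop :=
  set_fun (elts a) (elts b) f /\
  forall c, vmem c b -> exists2 d, vmem d a & ole c (f d).

Definition has_cof (b a : V) : Prop :=
  [/\ ordinal a, exists f, cofinal_map f a b
    & forall a', vmem a' a -> ~ exists f, cofinal_map f a' b].

(* P_{omega_1}(omega_2) *)
Definition Pomega1 : set V := [set a | vsub a omega2 /\ countable (elts a)].

Definition club_P (D : set V) : Prop :=
  [/\ D `<=` Pomega1,
      forall a, Pomega1 a -> exists2 c, D c & vsub a c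
    & forall c : nat -> V, (forall n, D (c n)) ->
        (forall n, vsub (c n) (c n.+1)) ->
        D (mkset (\bigcup_n elts (c n)))].

Definition stationary_P (Y : set V) : Prop :=
  Y `<=` Pomega1 /\ forall D, club_P D -> Y `&` D !=set0.

Definition thin (Y : set V) : Prop :=
  forall b, vmem b omega2 -> (fun a => vinter a b) @` Y #<= elts omega1.

Definition initial_closed (Y : set V) : Prop :=
  forall a b, Y a -> vmem b omega2 -> Y (vinter a b).

(* First-order formulas, with de Bruijn indices, in the language of the
   structure (H(omega_2), \in, pi, Y). *)
Inductive formula : Type :=
| FEq (i j : nat)
| FMem (i j : nat)
| FPi (i j : nat)
| FY (i : nat)
| FNot (phi : formula)
| FAnd (phi psi : formula)
| FEx (phi : formula).

Section Structure.
Variables (pi : V -> V) (Y : set V).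

(* Variables beyond the environment denote the empty set, which is definable
   without parameters. *)
Fixpoint sat (e : seq V) (phi : formula) : Prop :=
  match phi with
  | FEq i j => nth empty e i = nth empty e j
  | FMem i j => vmem (nth empty e i) (nth empty e j)
  | FPi i j => vmem (nth empty e i) omega2 /\ pi (nth empty e i) = nth empty e j
  | FY i => Y (nth empty e i)
  | FNot phi => ~ sat e phi
  | FAnd phi psi => sat e phi /\ sat e psi
  | FEx phi => exists2 x, H_omega2 x & sat (x :: e) phi
  end.

(* The witness for phi which is least in the well-ordering induced by pi,
   and pi(0) when there is no witness. *)
Definition skolem (phi : formula) (e : seq V) : V :=
  pi (xget empty [set xi | [/\ vmem xi omega2, sat (pi xi :: e) phi
                   & forall eta, vmem eta xi -> ~ sat (pi eta :: e) phi]]).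

Definition skolem_closed (S : set V) : Prop :=
  forall phi e, (forall x, x \in e -> S x) -> S (skolem phi e).

Definition Sk (a : set V) : set V :=
  \bigcap_(S in [set S | a `<=` S /\ skolem_closed S]) S.

Definition C : set V :=
  [set b | vmem b omega2 /\ Sk (elts b) `&` elts omega2 = elts b].

Definition limit_point (D : set V) (b : V) : Prop :=
  b <> empty /\ forall c, vmem c b -> exists d, [/\ D d, vmem c d & vmem d b].

Definition Lambda : set V :=
  [set b | [/\ vmem b omega2, has_cof b omega1 & limit_point C b]].

Definition X : set V :=
  [set M | [/\ Y M, Sk (elts M) `&` elts omega2 = elts M
             & forall c, vmem c M -> vmem (osup (C `&` elts c)) M]].

Section Adequate.
Variable Gamma : set V.

Definition is_min (S : set V) (b : V) : Prop := S b /\ forall c, S c -> ole b c.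
Definition is_max (S : set V) (b : V) : Prop := S b /\ forall c, S c -> ole c b.

Definition Gamma_ (M : V) : set V :=
  [set b | Gamma b /\ is_min (Gamma `\` elts (osup (elts (vinter M b)))) b].

Definition comparison (M N : V) : V :=
  xget empty (is_max (Gamma_ M `&` Gamma_ N)).

Definition adequate (A : set V) : Prop :=
  A `<=` X /\
  forall M N, A M -> A N ->
    let b := comparison M N in
    [\/ vinter M b = vinter N b,
        Sk (elts N) (vinter M b)
      | Sk (elts M) (vinter N b)].

End Adequate.
End Structure.

(* The relation le p q reads "p is stronger than q". *)
Record forcing : Type := Forcing {
  cond :> Type;
  le : cond -> cond -> Prop;
  one : cond;
  le_refl : forall p, le p p;
  le_trans : forall p q r, le p q -> le q r -> le p r;
  le_one : forall p, le p one }.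

Definition ointerval (a b : V) : set V :=
  [set c | (ole a c /\ ole c b) \/ (ole b c /\ ole c a)].

(* A finite partial function is given by its graph. *)
Definition finite_pfun (f : set (V * V)) : Prop :=
  [/\ finite_set f, f `<=` elts omega2 `*` elts omega2
    & forall a b b', f (a, b) -> f (a, b') -> b = b'].

Section Poset.
Variables (pi : V -> V) (Y : set V).

Record condition : Type := Condition {
  fpart : set (V * V);
  Apart : set V;
  fpart_pfun : finite_pfun fpart;
  Apart_fin : finite_set Apart;
  Apart_adequate : adequate pi Y (Lambda pi Y) Apart;
  cond_compat : forall M a b, Apart M -> fpart (a, b) ->
    elts M `&` ointerval a b !=set0 -> vmem a M /\ vmem b M }.

Definition cond_le (q p : condition) : Prop :=
  Apart p `<=` Apart q /\ fpart p `<=` fpart q.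

Lemma cond_le_refl p : cond_le p p.
Proof. by split. Qed.

Lemma cond_le_trans p q r : cond_le p q -> cond_le q r -> cond_le p r.
Proof.
by move=> [Aqp fqp] [Arq frq]; split; [exact: subset_trans Aqp|exact: subset_trans fqp].
Qed.

Lemma finite_pfun0 : finite_pfun set0.
Proof. by split=> //; exact: sub0set. Qed.

Lemma adequate0 : adequate pi Y (Lambda pi Y) set0.
Proof. by split=> //; exact: sub0set. Qed.

Lemma cond_compat0 M a b : set0 M -> (set0 : set (V * V)) (a, b) ->
  elts M `&` ointerval a b !=set0 -> vmem a M /\ vmem b M.
Proof. by []. Qed.

Definition cond_one : condition :=
  Condition finite_pfun0 (finite_set0 V) adequate0 cond_compat0.

Lemma cond_le_one p : cond_le p cond_one.
Proof. by split. Qed.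

Definition PP : forcing :=
  Forcing cond_le_refl cond_le_trans cond_le_one.

End Poset.

Section ForcingRelation.
Variable P : forcing.

(* P-names: families of pairs (name, condition). *)
Inductive name : Type :=
  Name (A : small) (f : A -> name) (c : A -> P).

Fixpoint check_tree (t : tree) : name :=
  match t with Tree A f => Name (fun i => check_tree (f i)) (fun=> one P) end.

Definition check (x : V) : name := check_tree (repr x).

(* A formula of the forcing language with names as parameters is represented
   by the set of conditions forcing it; the connectives below are the clauses
   of the recursive definition of the forcing relation. *)
Definition fprop := P -> Prop.

Definition dense_below (D : P -> Prop) (p : P) : Prop :=
  forall q, le q p -> exists2 r, le r q & D r.

(* p forces x = y when, for each (z, s) in x and each q <= p, s, the condition
   q forces z \in y, and symmetrically.  The membership clause f_mem is inlined
   to make the recursion structural; in the second half, f_eq (g j) (f i) is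
   written f_eq (f i) (g j) for the same reason. *)
Fixpoint f_eq (x y : name) {struct x} : fprop := fun p =>
  match x, y with
  | Name A f c, Name B g d =>
    (forall i q, le q p -> le q (c i) ->
      dense_below (fun r => exists2 j, le r (d j) & f_eq (f i) (g j) r) q) /\
    (forall j q, le q p -> le q (d j) ->
      dense_below (fun r => exists2 i, le r (c i) & f_eq (f i) (g j) r) q)
  end.

Definition f_mem (x y : name) : fprop :=
  let: Name B g d := y in
  dense_below (fun r => exists2 j, le r (d j) & f_eq x (g j) r).

Definition f_not (phi : fprop) : fprop := fun p => forall q, le q p -> ~ phi q.
Definition f_and (phi psi : fprop) : fprop := fun p => phi p /\ psi p.
Definition f_all (phi : name -> fprop) : fprop := fun p => forall x, phi x p.

Definition f_or phi psi := f_not (f_and (f_not phi) (f_not psi)).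
Definition f_imp phi psi := f_not (f_and phi (f_not psi)).
Definition f_iff phi psi := f_and (f_imp phi psi) (f_imp psi phi).
Definition f_ex (phi : name -> fprop) := f_not (f_all (fun x => f_not (phi x))).
Definition f_all_in y phi := f_all (fun x => f_imp (f_mem x y) (phi x)).
Definition f_ex_in y phi := f_ex (fun x => f_and (f_mem x y) (phi x)).

Definition f_transitive x :=
  f_all_in x (fun y => f_all_in y (fun z => f_mem z x)).
Definition f_ordinal x :=
  f_and (f_transitive x) (f_all_in x f_transitive).

(* z = {x, y} and z = (x, y) *)
Definition f_upair z x y :=
  f_all (fun w => f_iff (f_mem w z) (f_or (f_eq w x) (f_eq w y))).
Definition f_pair z x y :=
  f_ex (fun u => f_ex (fun v =>
    f_and (f_upair u x x) (f_and (f_upair v x y) (f_upair z u v)))).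

Definition f_app h x y := f_ex_in h (fun z => f_pair z x y).

Definition f_bijection h a b :=
  f_and
    (f_all_in h (fun z =>
       f_ex_in a (fun x => f_ex_in b (fun y => f_pair z x y))))
 (f_and
    (f_all_in a (fun x => f_ex_in b (fun y => f_app h x y)))
 (f_and
    (f_all (fun x => f_all (fun y => f_all (fun y' =>
       f_imp (f_and (f_app h x y) (f_app h x y')) (f_eq y y')))))
 (f_and
    (f_all (fun x => f_all (fun x' => f_all (fun y =>
       f_imp (f_and (f_app h x y) (f_app h x' y)) (f_eq x x')))))
    (f_all_in b (fun y => f_ex_in a (fun x => f_app h x y)))))).

(* A cardinal is an ordinal not in bijection with any smaller ordinal. *)
Definition f_cardinal k :=
  f_and (f_ordinal k)
    (f_all_in k (fun a => f_not (f_ex (fun h => f_bijection h a k)))).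

Definition preserves_cardinal (k : V) : Prop :=
  forall p : P, f_cardinal (check k) p.

End ForcingRelation.

(* Main.v *)
Require Import Defs.
From mathcomp Require Import all_boot.
From mathcomp Require Import boolp classical_sets functions cardinality.
(* MathComp shadows ordinal, mkset and other names of Defs. *)
Import Defs.

Set Implicit Arguments.
Unset Strict Implicit.
Unset Printing Implicit Defensive.

Local Open Scope classical_set_scope.
Local Open Scope card_scope.
Local Open Scope quotient_scope.

(* Let beta in Lambda be closed under enough functions, and let p be a condition
   in the hull of beta.  Pick M in X containing beta and the finitely many
   ordinals on which p depends, and add both M and its trace M \cap beta to p.
   Below the resulting condition q no pair (alpha, f(alpha)) crosses beta: it
   would have to lie in M, hence in M \cap beta.  So a condition r <= q can be
   traced on beta (restrict f, replace K by K \cap beta); by thinness the trace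
   lies in the hull of beta, and every extension of it in that hull is compatible
   with r, because Gamma_(K \cap beta) is Gamma_K cut at beta.  If p forced h to
   map some a < omega_2 onto omega_2, then some r <= q would force h(x) = beta
   with x < a, while an extension in the hull of its trace decides h(x) to be
   less than beta. *)

(** * Sets and ordinals *)

(** Closure under functions replaces an elementary submodel of a larger structure. The function that
    extends a condition so as to decide [h] at a point is arbitrary, not definable over [H_omega2].
    But a condition is coded by finitely many ordinals, so at most omega_1 conditions live below a
    given bound, and the values of the function on them are bounded below omega_2. [Lambda_reflect]
    turns such bounds into closure of beta. Cofinality omega_1 of beta makes a countable trace K
    \cap beta equal to K \cap gamma for some gamma < beta, which is where thinness can supply a code
    below beta. Membership of beta in Gamma is what allows comparison points to be cut at beta.
    Neither of the two added models is enough alone: M permits crossing pairs with both ends in M,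
    and M \cap beta permits crossing pairs whose interval misses it. *)

Lemma pi_bisim t u : \pi_V t = \pi_V u <-> bisim t u.
Proof.
split=> [/eqmodP /asboolP //|tu]; by apply/eqmodP/asboolP.
Qed.

Lemma vmem_pi x A (f : A -> tree) :
  vmem x (\pi_V (Tree f)) <-> exists i, x = \pi_V (f i).
Proof.
rewrite /vmem; have : bisim (repr (\pi_V (Tree f))) (Tree f).
  by apply/pi_bisim; rewrite reprK.
case: (repr _) => B g /= [gf fg]; split.
  by move=> [i ->]; have [j /pi_bisim ij] := gf i; exists j.
by move=> [i ->]; have [j /pi_bisim ij] := fg i; exists j.
Qed.

Lemma Vext x y : elts x = elts y -> x = y.
Proof.
move=> exy; rewrite -[x]reprK -[y]reprK; apply/pi_bisim.
have hx z : vmem z x <-> vmem z y.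
  by change (elts x z <-> elts y z); rewrite exy.
move: hx; rewrite -{1}[x]reprK -{1}[y]reprK.
case: (repr x) (repr y) => [A f] [B g] h /=; split=> i.
  have /h /vmem_pi [j /pi_bisim] : vmem (\pi_V (f i)) (\pi_V (Tree f)).
    by apply/vmem_pi; exists i.
  by exists j.
have /h /vmem_pi [j /esym/pi_bisim] : vmem (\pi_V (g i)) (\pi_V (Tree g)).
  by apply/vmem_pi; exists i.
by exists j.
Qed.

Lemma vextP x y : (forall z, vmem z x <-> vmem z y) -> x = y.
Proof. by move=> h; apply: Vext; rewrite predeqE => z; exact: h. Qed.

(** [mkset] and [osup] fall back to [empty] on a proper class, so their membership rules carry this
    side condition. *)
Definition is_small (S : set V) := exists v, elts v = S.

Lemma elts_mksetE (S : set V) : is_small S -> elts (mkset S) = S.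
Proof. by move=> [v vS]; rewrite /mkset; case: xgetP => // /(_ v). Qed.

Lemma mksetP (S : set V) x : is_small S -> vmem x (mkset S) <-> S x.
Proof. by move=> sS; change (elts (mkset S) x <-> S x); rewrite elts_mksetE. Qed.

(** Replacement and separation in one: the tree branches over the subtype of indices whose value
    lies in [S]. The other smallness lemmas reduce to it. *)
Lemma small_range (A : small) (F : A -> V) (S : set V) :
  S `<=` range F -> is_small S.
Proof.
move=> SF; exists (\pi_V (Tree (fun i : {i : A | S (F i)} => repr (F (sval i))))).
rewrite predeqE => x; split; first by move=> /vmem_pi[[i Fi] ->]; rewrite reprK.
move=> Sx; have [i _ Fi] := SF _ Sx; apply/vmem_pi.
by rewrite -Fi in Sx *; exists (exist (fun i => S (F i)) i Sx); rewrite reprK.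
Qed.

Lemma small_sub (S : set V) x : S `<=` elts x -> is_small S.
Proof.
move=> Sx; apply: (@small_range (branch (repr x)) (fun i => \pi_V (child i))).
by move=> y /Sx [i ->]; exists i.
Qed.

Lemma small_image (S : set V) (F : V -> V) : is_small S -> is_small (F @` S).
Proof.
move=> [v <-].
apply: (@small_range (branch (repr v)) (fun i => F (\pi_V (child i)))).
by move=> _ [x [i ->] <-]; exists i.
Qed.

Lemma small_bigcup (S : set V) (F : V -> set V) : is_small S ->
  (forall x, S x -> is_small (F x)) -> is_small (\bigcup_(x in S) F x).
Proof.
move=> [v <-] sF; have vF (i : branch (repr v)) : vmem (\pi_V (child i)) v by exists i.
apply: (@small_range {i : branch (repr v) & branch (repr (mkset (F (\pi_V (child i)))))}
  (fun p => \pi_V (child (projT2 p)))).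
move=> x [_ [i ->] Fx].
have : elts (mkset (F (\pi_V (child i)))) x by rewrite elts_mksetE //; apply/sF/vF.
by move=> [j ->]; exists (existT _ i j).
Qed.

Lemma small_countable (S : set V) : countable S -> is_small S.
Proof.
move=> /countable_injP[f fi].
apply: (@small_range nat (fun n => xget empty [set x | S x /\ f x = n])) => x Sx.
exists (f x) => //.
case: xgetP => [y _ [Sy fy]|/(_ x)/=]; last by move=> /(_ (conj Sx erefl)).
by apply: fi => //; rewrite inE.
Qed.

Lemma elts_empty : elts empty = set0.
Proof. by rewrite predeqE => x; split=> // /vmem_pi[[]]. Qed.

Lemma vmem_empty x : ~ vmem x empty.
Proof. by rewrite -[vmem _ _]/(elts empty x) elts_empty. Qed.

Lemma vmem_wf : well_founded vmem.
Proof.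
suff acc t : Acc vmem (\pi_V t) by move=> x; rewrite -[x]reprK.
by elim: t => A f IH; constructor => y /vmem_pi[i ->].
Qed.

Lemma vmem_ind (P : V -> Prop) :
  (forall x, (forall y, vmem y x -> P y) -> P x) -> forall x, P x.
Proof. exact: (well_founded_ind vmem_wf). Qed.

Lemma vmem_irr x : ~ vmem x x.
Proof. by elim/vmem_ind: x => x IH xx; exact: (IH x xx xx). Qed.

Lemma vmem_asym x y : vmem x y -> ~ vmem y x.
Proof. by elim/vmem_ind: x y => x IH y xy yx; exact: (IH y yx x yx xy). Qed.

(** Masking with [b0] outside [x] lets [step] take a total function, so the recursion equation
    rewrites without dependent arguments. *)
Lemma wf_rec (B : Type) (step : V -> (V -> B) -> B) (b0 : B) :
  exists f : V -> B, forall x,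
    f x = step x (fun y => if `[< vmem y x >] then f y else b0).
Proof.
pose F x (g : forall y, vmem y x -> B) : B := step x (fun y =>
  match pselect (vmem y x) with left h => g y h | right _ => b0 end).
exists (Fix vmem_wf (fun=> B) F) => x; rewrite Fix_eq; last first.
  move=> {}x f g fg; rewrite /F; congr step; apply/funext => y.
  by case: pselect => // h; exact: fg.
rewrite {1}/F; congr step; apply/funext => y.
by case: pselect => h; [rewrite asboolT | rewrite asboolF].
Qed.

Lemma vinterE a b x : vmem x (vinter a b) <-> vmem x a /\ vmem x b.
Proof.
rewrite -[vmem _ _]/(elts (vinter a b) x) /vinter elts_mksetE //.
by apply: (@small_sub _ a) => y [].
Qed.

Lemma osupE (S : set V) x : is_small S ->
  vmem x (osup S) <-> exists2 y, S y & vmem x y.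
Proof.
move=> sS; rewrite -[vmem _ _]/(elts (osup S) x) /osup elts_mksetE //.
have -> : [set x | exists2 y, S y & vmem x y] = \bigcup_(y in S) elts y.
  by rewrite predeqE => z; split=> -[y]; exists y.
by apply: small_bigcup => // y _; exists y.
Qed.

Lemma vinter_id a b : vsub a b -> vinter a b = a.
Proof.
by move=> ab; apply: vextP => x; rewrite vinterE; split=> [[]//|xa]; split=> //; exact: ab.
Qed.

Lemma ord_trans a x y : vmem x y -> vmem y a -> ordinal a -> vmem x a.
Proof. by move=> xy ya [ta _]; exact: ta ya _ xy. Qed.

Lemma ord_mem a x : vmem x a -> ordinal a -> ordinal x.
Proof.
by move=> xa oa; split; [exact: oa.2|move=> y yx; apply/oa.2/(ord_trans yx)].
Qed.

Lemma ord_total a b : ordinal a -> ordinal b -> [\/ vmem a b, a = b | vmem b a].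
Proof.
elim/vmem_ind: a b => a IHa b oa; elim/vmem_ind: b => b IHb ob.
case: (pselect (vmem a b)) => [?|nab]; first exact: Or31.
case: (pselect (vmem b a)) => [?|nba]; first exact: Or33.
apply: Or32; apply: vextP => x; split=> h.
  case: (IHa _ h b (ord_mem h oa) ob) => // [xb|bx]; first by rewrite xb in h.
  by case: nba; exact: (ord_trans bx h).
case: (IHb _ h (ord_mem h ob)) => // [ax|ax]; first by case: nab; exact: (ord_trans ax h).
by rewrite ax in nab *.
Qed.

Lemma ord_leP a b : ordinal a -> ordinal b -> ~ vmem b a -> ole a b.
Proof. by move=> oa ob nba; case: (ord_total oa ob); [left|right|]. Qed.

Lemma ole_sub a b : ordinal b -> ole a b -> vsub a b.
Proof. by move=> ob [ab|->] // x xa; exact: (ord_trans xa ab). Qed.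

Lemma sub_ole a b : ordinal a -> ordinal b -> vsub a b -> ole a b.
Proof. by move=> oa ob ab; apply: ord_leP => // /ab /vmem_irr. Qed.

Lemma ole_notlt a b : ole a b -> ~ vmem b a.
Proof. by move=> [/vmem_asym//|->]; exact: vmem_irr. Qed.

Lemma ole_lt_trans a b c : ole a b -> vmem b c -> ordinal c -> vmem a c.
Proof. by move=> [ab bc oc|->//]; exact: (ord_trans ab bc). Qed.

Lemma lt_ole_trans a b c : vmem a b -> ole b c -> ordinal c -> vmem a c.
Proof. by move=> ab [bc oc|<-//]; exact: (ord_trans ab bc). Qed.

Lemma ole_trans a b c : ole a b -> ole b c -> ordinal c -> ole a c.
Proof.
move=> [ab|->] // bc oc; left; exact: (lt_ole_trans ab bc).
Qed.

Lemma ord_least (S : set V) : (exists2 x, S x & ordinal x) ->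
  exists x, [/\ S x, ordinal x & forall y, ordinal y -> S y -> ole x y].
Proof.
move=> [x Sx ox]; elim/vmem_ind: x Sx ox => x IH Sx ox.
case: (pselect (exists2 y, vmem y x & S y)) => [[y yx Sy]|nS].
  by apply: (IH y) => //; exact: (ord_mem yx).
exists x; split=> // y oy Sy; apply: ord_leP => // yx; by apply: nS; exists y.
Qed.

Lemma ord_osup (S : set V) : is_small S -> (forall x, S x -> ordinal x) ->
  ordinal (osup S).
Proof.
move=> sS oS; split=> [y /(osupE _ sS) [z Sz yz] x xy|y /(osupE _ sS) [z Sz yz]].
  by apply/osupE => //; exists z => //; apply: (ord_trans xy yz); exact: oS.
exact: (oS _ Sz).2.
Qed.

Lemma osup_ub (S : set V) x : is_small S -> (forall y, S y -> ordinal y) ->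
  S x -> ole x (osup S).
Proof.
move=> sS oS Sx; apply: sub_ole; [exact: oS|exact: ord_osup|].
by move=> y yx; apply/osupE => //; exists x.
Qed.

Lemma osup_lub (S : set V) b : is_small S -> (forall y, S y -> ordinal y) ->
  ordinal b -> (forall y, S y -> ole y b) -> ole (osup S) b.
Proof.
move=> sS oS ob Sb; apply: sub_ole => //; first exact: ord_osup.
by move=> y /(osupE _ sS) [z /Sb zb yz]; exact: (lt_ole_trans yz zb).
Qed.

Definition osucc (a : V) : V := mkset (elts a `|` [set a]).

Lemma osuccE a x : vmem x (osucc a) <-> ole x a.
Proof.
rewrite -[vmem _ _]/(elts (osucc a) x) elts_mksetE; first by split=> -[]; [left|right|left|right].
apply: (@small_range (option (branch (repr a)))
  (fun o => if o is Some i then \pi_V (child i) else a)).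
by move=> y [[i ->]|->]; [exists (Some i)|exists None].
Qed.

Lemma ord_succ a : ordinal a -> ordinal (osucc a).
Proof.
move=> oa; split=> [y /osuccE ya x xy|y /osuccE [ya|->]]; last exact: oa.1.
  by apply/osuccE; left; exact: (lt_ole_trans xy ya).
exact: oa.2.
Qed.

(** Burali-Forti: a set of all ordinals would itself be an ordinal, hence its own element. *)
Lemma not_small_ord : ~ is_small ordinal.
Proof.
move=> [v ov]; have oE x : vmem x v <-> ordinal x by rewrite -[vmem _ _]/(elts v x) ov.
have : ordinal v.
  split=> [y /oE oy x xy|y /oE []//]; by apply/oE; exact: (ord_mem xy).
by move=> /oE /vmem_irr.
Qed.

(** An isomorphism of ordinals is the identity, by induction on membership. *)
Lemma ord_iso a b (g : V -> V) : ordinal a -> ordinal b ->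
  (forall x, vmem x a -> vmem (g x) b) ->
  (forall y, vmem y b -> exists2 x, vmem x a & g x = y) ->
  (forall x y, vmem x a -> vmem y a -> vmem x y <-> vmem (g x) (g y)) -> a = b.
Proof.
move=> oa ob gab gs gm.
have gid x : vmem x a -> g x = x.
  elim/vmem_ind: x => x IH xa; apply: vextP => y; split=> h.
    have [z za zy] := gs y (ord_trans h (gab _ xa) ob); rewrite -zy in h *.
    have zx : vmem z x by exact/(gm _ _ za xa).
    by rewrite IH.
  by have ya := ord_trans h xa oa; have := (gm _ _ ya xa).1 h; rewrite (IH y h ya).
apply: vextP => x; split=> h; first by rewrite -(gid _ h); exact: gab.
by have [y ya <-] := gs _ h; rewrite gid.
Qed.

Lemma card_leI T U (A : set T) (B : set U) (f : T -> U) :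
  (forall x, A x -> B (f x)) -> (forall x y, A x -> A y -> f x = f y -> x = y) ->
  A #<= B.
Proof.
move=> fAB fi; have fA : f @` A #= A.
  by apply: inj_card_eq => x y; rewrite !inE; exact: fi.
have fB : f @` A `<=` B by move=> _ [x Ax <-]; exact: fAB.
apply: card_le_trans (subset_card_le fB).
by move: fA; rewrite card_eq_le => /andP[].
Qed.

Lemma card_leE T U (A : set T) (B : set U) (u0 : U) : A #<= B ->
  exists f : T -> U, (forall x, A x -> B (f x)) /\
    (forall x y, A x -> A y -> f x = f y -> x = y).
Proof.
move=> /card_leP[f].
exists (fun x => match pselect (A x) with
  | left h => set_val (f (exist _ x (mem_set h))) | right _ => u0 end); split.
  by move=> x Ax; case: pselect => // h; apply/set_mem/(valP (f _)).
move=> x y Ax Ay; do 2 case: pselect => // ?.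
by move=> /val_inj /(@inj _ _ _ f) h; have /(congr1 set_val) := h (mem_set I) (mem_set I).
Qed.

(* Hartogs: an ordinal embedding into A is determined by the relation that the
   embedding induces on A, and these relations form a small type. *)
Lemma hartogs (A : small) (i0 : A) : exists2 a, ordinal a & ~ (elts a #<= [set: A]).
Proof.
apply: contrapT => nA.
have oA a : ordinal a -> elts a #<= [set: A].
  by move=> oa; apply: contrapT => na; apply: nA; exists a.
pose rep (p : (A -> Prop) * (A -> A -> Prop)) (a : V) := ordinal a /\
  exists f : V -> A, [/\ forall x y, vmem x a -> vmem y a -> f x = f y -> x = y,
    forall i, p.1 i <-> exists2 x, vmem x a & f x = i
    & forall x y, vmem x a -> vmem y a -> vmem x y <-> p.2 (f x) (f y)].
have rep_inj p a b : rep p a -> rep p b -> a = b.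
  move=> [oa [f [fi f1 f2]]] [ob [g [gi g1 g2]]].
  have /choice[h hP] x : exists y, vmem x a -> vmem y b /\ g y = f x.
    case: (pselect (vmem x a)) => [xa|]; last by exists empty.
    have /g1[y yb gy] : p.1 (f x) by apply/f1; exists x.
    by exists y.
  apply: (@ord_iso a b h oa ob) => [x /hP[]//|y yb|x y xa ya].
    have /f1[x xa fx] : p.1 (g y) by apply/g1; exists y.
    by have [hb gh] := hP _ xa; exists x => //; apply: gi => //; rewrite gh.
  have [hxb ghx] := hP _ xa; have [hyb ghy] := hP _ ya.
  by rewrite f2 // g2 // ghx ghy.
apply: not_small_ord.
apply: (@small_range _ (fun p => xget empty (rep p))) => a oa.
have /(card_leE i0)[f [_ fi]] := oA a oa.
pose p := (fun i => exists2 x, vmem x a & f x = i,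
    fun i j => exists x y, [/\ vmem x a, vmem y a, f x = i, f y = j & vmem x y]).
  have pa : rep p a.
    split=> //; exists f; split=> // x y xa ya; split=> [xy|]; first by exists x, y.
    by move=> [x' [y' [x'a y'a /fi-> // /fi-> //]]].
  exists p => //; case: xgetP => [b _ pb|/(_ a)//]; exact: (rep_inj _ _ _ pb pa).
Qed.

(** * Sets of size at most omega_1 *)

(** [omega1] is picked by [xget], so its properties require an existence proof: Hartogs yields an
    uncountable ordinal, and the least one qualifies. *)
Lemma omega1P : [/\ ordinal omega1, ~ countable (elts omega1)
  & forall b, vmem b omega1 -> countable (elts b)].
Proof.
rewrite /omega1; case: xgetP => [a _ //|].
have [a oa na] := hartogs 0%N.
have [b [nb ob bmin]] := @ord_least [set a | ~ countable (elts a)] (ex_intro2 _ _ a na oa).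
move=> /(_ b) []; split=> // c cb; apply: contrapT => nc.
have [] := ole_notlt (bmin c (ord_mem cb ob) nc); exact: cb.
Qed.

Lemma omega1_gt0 : exists x, vmem x omega1.
Proof.
have [_ nc _] := omega1P; apply: contrapT => n; apply: nc.
suff -> : elts omega1 = set0 by exact: countable0.
by rewrite -subset0 => x xo; apply: n; exists x.
Qed.

Lemma omega2P : [/\ ordinal omega2, ~ (elts omega2 #<= elts omega1)
  & forall b, vmem b omega2 -> elts b #<= elts omega1].
Proof.
rewrite /omega2; case: xgetP => [a _ //|].
have [_ [i0 _]] := omega1_gt0.
have [a oa na] := hartogs i0.
have {}na : ~ (elts a #<= elts omega1).
  (* Hartogs was applied to the branch type of [omega1], which maps onto the elements of
     [omega1]. *)
  move=> ale; apply: na; apply: (card_le_trans ale).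
  have -> : elts omega1 = (fun i => \pi_V (child i)) @` [set: branch (repr omega1)].
    by rewrite predeqE => x; split=> [[i ->]|[i _ <-]]; [exists i|exists i].
  exact: card_image_le.
have [b [nb ob bmin]] :=
  @ord_least [set a | ~ (elts a #<= elts omega1)] (ex_intro2 _ _ a na oa).
move=> /(_ b) []; split=> // c cb; apply: contrapT => nc.
have [] := ole_notlt (bmin c (ord_mem cb ob) nc); exact: cb.
Qed.

Lemma ord_omega2 : ordinal omega2. Proof. by have [] := omega2P. Qed.

Definition le1 T (A : set T) := A #<= elts omega1.

Lemma nat_le1 : le1 [set: nat].
Proof.
apply/infiniteP => /finite_set_countable; by have [_] := omega1P.
Qed.

Lemma countable_le1 T (A : set T) : countable A -> le1 A.
Proof. by move=> cA; apply: card_le_trans nat_le1. Qed.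

Lemma le1_sub T (A B : set T) : A `<=` B -> le1 B -> le1 A.
Proof. by move=> /subset_card_le AB; apply: card_le_trans. Qed.

Lemma le1_image T U (f : T -> U) (A : set T) : le1 A -> le1 (f @` A).
Proof. by apply: card_le_trans; exact: card_image_le. Qed.

Lemma le1_inj T U (A : set T) (B : set U) (f : T -> U) :
  (forall x, A x -> B (f x)) -> (forall x y, A x -> A y -> f x = f y -> x = y) ->
  le1 B -> le1 A.
Proof. by move=> fAB fi; apply: card_le_trans; exact: card_leI fAB fi. Qed.

Lemma le1E T (A : set T) : le1 A -> exists f : T -> V,
  (forall x, A x -> vmem (f x) omega1) /\
  (forall x y, A x -> A y -> f x = f y -> x = y).
Proof. by move=> /(card_leE empty). Qed.

(** By recursion, each a < omega_1 receives an injective sequence in omega_1 that avoids the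
    sequences of all b < a. Those cover only a countable set, so the rest of omega_1 is infinite. *)
Lemma le1_omega1nat : le1 (elts omega1 `*` [set: nat]).
Proof.
have [oo nc co] := omega1P.
have /choice[step stepP] (S : set V) : exists g : nat -> V, countable S ->
    [/\ forall n, vmem (g n) omega1, forall n, ~ S (g n) & injective g].
  case: (pselect (countable S)) => cS; last by exists (fun=> empty).
  have /infiniteP/(card_leE empty)[g [gS gi]] : infinite_set (elts omega1 `\` S).
    move=> /finite_set_countable cD; apply: nc.
    apply: (@sub_countable _ _ _ ((elts omega1 `\` S) `|` S)).
      by apply: subset_card_le => x xo; case: (pselect (S x)); [right|left].
    by rewrite -bigcup2inE; apply: bigcup_countable => // -[|[|]].
  exists g => _; split=> [n|n|m n /gi]; last by apply.
    by have [] := gS n I.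
  by have [] := gS n I.
have [f fE] := wf_rec (fun a g => step (\bigcup_(y in elts a) range (g y))) (fun=> empty).
have fP a : vmem a omega1 -> [/\ forall n, vmem (f a n) omega1,
    forall b, vmem b a -> forall m n, f b m <> f a n & injective (f a)].
  move=> ao; rewrite fE; set S := \bigcup_(_ in _) _.
  have /stepP[s1 s2 s3] : countable S.
    apply: bigcup_countable; first exact: co.
    by move=> b _; apply: sub_countable (countableP setT); exact: card_image_le.
  split=> // b ba m n fb; apply: (s2 n); rewrite -fb; exists b => //=.
  by exists m; rewrite ?asboolT.
apply: (@le1_inj _ _ _ (elts omega1) (fun p => f p.1 p.2)); last exact: card_lexx.
  by move=> [a n] [/= /fP[fa _ _] _]; exact: fa.
move=> [a n] [b m] [/= ao _] [/= bo _] e.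
have [_ fa ia] := fP _ ao; have [_ fb _] := fP _ bo.
case: (ord_total (ord_mem ao oo) (ord_mem bo oo)) => [ab|ab|ba].
- by have := fb _ ab n m.
- by rewrite -ab in e *; rewrite (ia _ _ e).
- by have /(_ m n) := fa _ ba; rewrite e.
Qed.

(* Pairs (a, b) with max(a, b) = c form a countable set for each c. *)
Lemma le1_omega1sq : le1 (elts omega1 `*` elts omega1).
Proof.
have [oo nc co] := omega1P.
pose slice c := [set p : V * V | vmem p.1 (osucc c) /\ vmem p.2 (osucc c)].
have sliceC c : vmem c omega1 -> countable (slice c).
  move=> /co cc; apply: (@countableX _ _ (elts (osucc c)) (elts (osucc c)));
  (have -> : elts (osucc c) = elts c `|` [set c] by
    rewrite predeqE => x; split=> /osuccE);
  by rewrite -bigcup2inE; apply: bigcup_countable => // -[|[|]] // _; exact: countable1.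
have /choice[e eP] c : exists e : V * V -> nat, vmem c omega1 ->
    forall p q, slice c p -> slice c q -> e p = e q -> p = q.
  case: (pselect (vmem c omega1)) => co1; last by exists (fun=> 0%N).
  by have /(card_leE 0%N)[e [_ ei]] := sliceC _ co1; exists e.
pose mx (p : V * V) := if `[< vmem p.1 p.2 >] then p.2 else p.1.
have mxP p : vmem p.1 omega1 -> vmem p.2 omega1 -> vmem (mx p) omega1 /\ slice (mx p) p.
  move=> p1 p2; rewrite /mx; case: asboolP => h; split=> //; split; apply/osuccE.
  - by left.
  - by right.
  - by right.
  by apply: ord_leP => //; apply: ord_mem oo.
apply: (@le1_inj _ _ _ (elts omega1 `*` [set: nat]) (fun p => (mx p, e (mx p) p)));
  last exact: le1_omega1nat.
  by move=> p [p1 p2]; split=> //=; have [] := mxP _ p1 p2.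
move=> p q [p1 p2] [q1 q2] [pq]; rewrite -pq.
have [m1 m2] := mxP _ p1 p2; have [n1 n2] := mxP _ q1 q2.
by apply: eP => //; rewrite pq.
Qed.

Lemma le1X T U (A : set T) (B : set U) : le1 A -> le1 B -> le1 (A `*` B).
Proof.
move=> /le1E[f [fA fi]] /le1E[g [gB gi]].
apply: (@le1_inj _ _ _ _ (fun p => (f p.1, g p.2)) _ _ le1_omega1sq).
  by move=> [a b] [/= /fA ? /gB].
by move=> [a b] [c d] [/= Aa Bb] [/= Ac Bd] [/(fi _ _ Aa Ac)-> /(gi _ _ Bb Bd)->].
Qed.

Lemma le1_bigcup T U (A : set T) (F : T -> set U) : le1 A ->
  (forall x, A x -> le1 (F x)) -> le1 (\bigcup_(x in A) F x).
Proof.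
move=> A1 F1; have /choice[g gP] x : exists g : U -> V, A x ->
    (forall y, F x y -> vmem (g y) omega1) /\
    (forall y z, F x y -> F x z -> g y = g z -> y = z).
  case: (pselect (A x)) => Ax; last by exists (fun=> empty).
  by have /le1E[g gP] := F1 _ Ax; exists g.
case: (pselect (exists a, A a)) => [[a0 Aa0]|nA]; last first.
  by apply: countable_le1; rewrite (_ : bigcup _ _ = set0) ?countable0 //
     -subset0 => y [x Ax]; case: nA; exists x.
have /choice[w wP] y : exists x, (\bigcup_(x in A) F x) y -> A x /\ F x y.
  by case: (pselect ((\bigcup_(x in A) F x) y)) => [[x Ax Fx]|n]; [exists x|exists a0].
apply: (@le1_inj _ _ _ _ (fun y => (w y, g (w y) y)) _ _ (le1X A1 (card_lexx _))).
  by move=> y /wP[Aw Fw]; split=> //=; exact: (gP _ Aw).1.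
move=> y z /wP[Aw Fw] /wP[Az Fz] [yz]; rewrite -yz in Fz *.
exact: (gP _ Aw).2.
Qed.

Lemma le1U T (A B : set T) : le1 A -> le1 B -> le1 (A `|` B).
Proof.
move=> A1 B1; rewrite -bigcup2E; apply: le1_bigcup.
  exact: countable_le1 (countableP _).
by move=> [|[|n]] _ //=; exact/countable_le1/countable0.
Qed.

Lemma le1_seq (T : eqType) (A : set T) : le1 A ->
  le1 [set s : seq T | forall x, x \in s -> A x].
Proof.
move=> A1; pose L n := [set s : seq T | size s = n /\ forall x, x \in s -> A x].
suff Ln n : le1 (L n).
  apply: (@le1_sub _ _ (\bigcup_(n in [set: nat]) L n)).
    by move=> s sA; exists (size s).
  by apply: le1_bigcup => //; exact: nat_le1.
elim: n => [|n IH].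
  apply: (@le1_sub _ _ [set [::]]); last exact/countable_le1/countable1.
  by move=> s [/size0nil].
apply: (@le1_sub _ _ ((fun p => p.1 :: p.2) @` (A `*` L n))).
  move=> [[]//|x s [[ss] sA]]; exists (x, s) => //; split=> /=.
    by apply: sA; rewrite mem_head.
  by split=> // y ys; apply: sA; rewrite inE ys orbT.
exact/le1_image/le1X.
Qed.

Lemma countable_seq (T : eqType) (A : set T) : countable A ->
  countable [set s : seq T | forall x, x \in s -> A x].
Proof.
move=> /(card_leE 0%N)[f [_ fi]].
apply: (@sub_countable _ _ _ [set: seq nat]); last exact: countableP.
apply: (@card_leI _ _ _ _ (map f)) => // s t.
elim: s t => [|x s IH] [|y t] //= sA tA [xy st].
congr cons; first by apply: fi xy; [exact/sA/mem_head|exact/tA/mem_head].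
by apply: IH st => z zs; [apply: sA|apply: tA]; rewrite inE zs orbT.
Qed.

(** Regularity of omega_2: an unbounded [S] would cover omega_2 by omega_1 many sets of size at most
    omega_1. *)
Lemma omega2_bounded (S : set V) : S `<=` elts omega2 -> le1 S ->
  exists2 d, vmem d omega2 & S `<=` elts d.
Proof.
move=> So S1; have [oo n2 o2] := omega2P; apply: contrapT => nb; apply: n2.
apply: (@le1_sub _ _ (\bigcup_(x in S) (elts (osucc x)))).
  move=> x xo; apply: contrapT => nx; apply: nb; exists x => // y Sy.
  apply: contrapT => nyx; apply: nx; exists y => //; apply/osuccE.
  by apply: ord_leP => //; [exact: (ord_mem xo oo)|exact: (ord_mem (So _ Sy) oo)].
apply: le1_bigcup => // x /So xo.
apply: (@le1_sub _ _ (elts x `|` [set x])); first by move=> y /osuccE.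
by apply: le1U; [exact: o2|exact/countable_le1/countable1].
Qed.

Lemma omega2_succ a : vmem a omega2 -> vmem (osucc a) omega2.
Proof.
move=> ao; have [d dO ad] : exists2 d, vmem d omega2 & [set a] `<=` elts d.
  by apply: omega2_bounded; [move=> _ ->|exact/countable_le1/countable1].
have od := ord_mem dO ord_omega2; have oa := ord_mem ao ord_omega2.
apply: (@ole_lt_trans _ d) => //; last exact: ord_omega2.
apply: sub_ole => //; first exact: ord_succ.
by move=> x /osuccE xa; apply: (@ole_lt_trans _ a) => //; exact: ad.
Qed.

Lemma omega1_bounded (S : set V) : S `<=` elts omega1 -> countable S ->
  exists2 d, vmem d omega1 & S `<=` elts d.
Proof.
move=> So S1; have [oo n2 o2] := omega1P; apply: contrapT => nb; apply: n2.
apply: (@sub_countable _ _ _ (\bigcup_(x in S) (elts (osucc x)))).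
  apply: subset_card_le.
  move=> x xo; apply: contrapT => nx; apply: nb; exists x => // y Sy.
  apply: contrapT => nyx; apply: nx; exists y => //; apply/osuccE.
  by apply: ord_leP => //; [exact: (ord_mem xo oo)|exact: (ord_mem (So _ Sy) oo)].
apply: bigcup_countable => // x /So xo.
apply: (@sub_countable _ _ _ (elts x `|` [set x])).
  by apply: subset_card_le => y /osuccE.
by rewrite -bigcup2inE; apply: bigcup_countable => // -[|[|]] // _;
  [exact: o2|exact: countable1].
Qed.

(** * Definability and Skolem hulls *)

(** Choosing a new element of [A] at each stage below omega_2 never gets stuck. This turns the
    negative definition of [H_omega2] into the bound in [HP]. *)
Lemma omega2_le T (A : set T) : ~ le1 A -> elts omega2 #<= A.
Proof.
move=> nA; have [oo n2 o2] := omega2P.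
have [t0 _] : A !=set0.
  by apply/set0P/eqP => A0; apply: nA; rewrite A0; exact/countable_le1/countable0.
have /choice[step stepP] (S : set T) : exists x, le1 S -> A x /\ ~ S x.
  case: (pselect (le1 S)) => S1; last by exists t0.
  apply: contrapT => n; apply: nA; apply: le1_sub S1 => x Ax.
  by apply: contrapT => nS; apply: n; exists x.
have [f fE] := wf_rec (fun a g => step (g @` elts a)) t0.
have fP a : vmem a omega2 -> A (f a) /\ forall b, vmem b a -> f b <> f a.
  move=> ao; rewrite [f a]fE; set S := _ @` _.
  have /stepP[Ax nS] : le1 S by apply: le1_image; exact: o2.
  split=> // b ba fb; apply: nS; rewrite -fb; exists b => //.
  by rewrite asboolT.
apply: (@card_leI _ _ _ _ f) => [a /fP[]//|a b ao bo fab].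
case: (ord_total (ord_mem ao oo) (ord_mem bo oo)) => // h.
  by have [_ /(_ _ h)] := fP _ bo.
by have [_ /(_ _ h)] := fP _ ao; rewrite fab.
Qed.

Lemma HP x : H_omega2 x <-> le1 (trcl x).
Proof.
split=> [Hx|x1 x2]; first by apply: contrapT => /omega2_le.
by have [_ + _] := omega2P; apply; exact: card_le_trans x1.
Qed.

Lemma H_mem x y : H_omega2 x -> vmem y x -> H_omega2 y.
Proof.
move=> /HP x1 yx; apply/HP; apply: le1_sub x1 => z zy.
by apply: Relation_Operators.t_trans zy _; exact: Relation_Operators.t_step.
Qed.

Lemma trclE x z : trcl x z -> vmem z x \/ exists2 y, vmem y x & trcl y z.
Proof.
rewrite /trcl /=; elim=> [a b|a b c ab IHa bc [h|[y yc]]]; first by left.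
  by right; exists b.
move=> yb; right; exists y => //; exact: Relation_Operators.t_trans yb.
Qed.

Lemma H_sub x y : H_omega2 y -> vsub x y -> H_omega2 x.
Proof.
move=> /HP y1 xy; apply/HP; apply: le1_sub y1 => z /trclE[zx|[w wx zw]].
  by apply: Relation_Operators.t_step; exact: xy.
by apply: Relation_Operators.t_trans zw _; apply: Relation_Operators.t_step; exact: xy.
Qed.

Lemma H_set x : le1 (elts x) -> elts x `<=` H_omega2 -> H_omega2 x.
Proof.
move=> x1 xH; apply/HP.
apply: (@le1_sub _ _ (elts x `|` \bigcup_(y in elts x) trcl y)).
  by move=> z /trclE[zx|[y yx zy]]; [left|right; exists y].
by apply: le1U => //; apply: le1_bigcup => // y /xH/HP.
Qed.

Lemma H_ord a : vmem a omega2 -> H_omega2 a.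
Proof.
elim/vmem_ind: a => a IH ao; have [oo _ o2] := omega2P.
by apply: H_set => [|b ba]; [exact: o2|apply: IH => //; exact: (ord_trans ba ao)].
Qed.

Lemma countable_formula : countable [set: formula].
Proof.
pose fix enc (phi : formula) : GenTree.tree nat := match phi with
  | FEq i j => GenTree.Node 0 [:: GenTree.Leaf i; GenTree.Leaf j]
  | FMem i j => GenTree.Node 1 [:: GenTree.Leaf i; GenTree.Leaf j]
  | FPi i j => GenTree.Node 2 [:: GenTree.Leaf i; GenTree.Leaf j]
  | FY i => GenTree.Node 3 [:: GenTree.Leaf i]
  | FNot a => GenTree.Node 4 [:: enc a]
  | FAnd a b => GenTree.Node 5 [:: enc a; enc b]
  | FEx a => GenTree.Node 6 [:: enc a] end.
apply: (@sub_countable _ _ _ [set: GenTree.tree nat]); last exact: countableP.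
apply: (@card_leI _ _ _ _ enc) => // phi psi _ _.
elim: phi psi => [i j|i j|i j|i|a IHa|a IHa b IHb|a IHa] [k l|k l|k l|k|c|c d|c] //=.
- by move=> [-> ->]. - by move=> [-> ->]. - by move=> [-> ->]. - by move=> [->].
- by move=> [/IHa->]. - by move=> [/IHa-> /IHb->]. - by move=> [/IHa->].
Qed.

Definition FImp a b := FNot (FAnd a (FNot b)).
Definition FAll a := FNot (FEx (FNot a)).
(* Satisfied when x is the intersection of k and g. *)
Definition FInter x k g :=
  FAll (FAnd (FImp (FMem 0 x.+1) (FAnd (FMem 0 k.+1) (FMem 0 g.+1)))
             (FImp (FAnd (FMem 0 k.+1) (FMem 0 g.+1)) (FMem 0 x.+1))).
(* A family w of sets induces the preorder: i <= j when every member of w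
   containing j contains i. *)
Definition FLe i j w :=
  FAll (FImp (FMem 0 w.+1) (FImp (FMem j.+1 0) (FMem i.+1 0))).
(** [y] is least among the elements of [k] not below [x]. Enumerating by successors avoids coding
    pairs and functions as formulas. *)
Definition FSucc x y w k :=
  FAnd (FMem x k) (FAnd (FMem y k) (FAnd (FNot (FLe y x w))
    (FAll (FImp (FMem 0 k.+1) (FImp (FNot (FLe 0 x.+1 w.+1)) (FLe y.+1 0 w.+1)))))).

(** The restriction to [H_omega2] copies the range of the quantifiers of [sat], so [sat_le] holds in
    every environment. *)
Definition leW w x y := forall I, H_omega2 I -> vmem I w -> vmem y I -> vmem x I.
Definition succW w k x y := [/\ vmem x k, vmem y k, ~ leW w y x &
  forall z, H_omega2 z -> vmem z k -> ~ leW w z x -> leW w y z].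

Lemma and3_iff (A B B' D D' : Prop) : (B <-> B') -> (D <-> D') ->
  A /\ (B /\ D) <-> [/\ A, B' & D'].
Proof. by move=> [BB' B'B] [DD' D'D]; split=> [[? [/BB' ? /DD']]|[? /B'B ? /D'D]]. Qed.

Section Skolem.
Variables (pi : V -> V) (Y : set V).
Hypothesis pi_bij : set_bij (elts omega2) H_omega2 pi.
Hypothesis YP : Y `<=` Pomega1.

Local Notation sat := (sat pi Y).
Local Notation Sk := (Sk pi Y).
Local Notation skolem := (skolem pi Y).

Lemma sat_notE e a : sat e (FNot a) = (~ sat e a).
Proof. by []. Qed.

Lemma sat_andE e a b : sat e (FAnd a b) = (sat e a /\ sat e b).
Proof. by []. Qed.

Lemma sat_imp e a b : sat e (FImp a b) <-> (sat e a -> sat e b).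
Proof.
by rewrite /=; split=> [n ha|h [/h]] //; apply: contrapT => nb; apply: n.
Qed.

Definition sat_impE e a b := propext (sat_imp e a b).

Lemma sat_all e a : sat e (FAll a) <-> forall x, H_omega2 x -> sat (x :: e) a.
Proof.
rewrite /=; split=> [n x Hx|h [x Hx]]; last by apply; exact: h.
by apply: contrapT => nx; apply: n; exists x.
Qed.

Definition sat_allE e a := propext (sat_all e a).

Lemma sat_le e i j w : sat e (FLe i j w) <->
  leW (nth empty e w) (nth empty e i) (nth empty e j).
Proof.
rewrite /FLe sat_allE; split=> h I HI; first by move: (h I HI); rewrite !sat_impE.
by rewrite !sat_impE; exact: h.
Qed.

Definition sat_leE e i j w := propext (sat_le e i j w).

Lemma sat_succ e x y w k : sat e (FSucc x y w k) <->
  succW (nth empty e w) (nth empty e k) (nth empty e x) (nth empty e y).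
Proof.
have -> : sat e (FSucc x y w k) <-> [/\ vmem (nth empty e x) (nth empty e k),
    vmem (nth empty e y) (nth empty e k), ~ sat e (FLe y x w) &
    sat e (FAll (FImp (FMem 0 k.+1)
      (FImp (FNot (FLe 0 x.+1 w.+1)) (FLe y.+1 0 w.+1))))].
  by split=> [[? [? []]]|[]].
rewrite sat_leE sat_allE; split=> -[h1 h2 h3 h4]; split=> // z Hz.
  move=> zk; have := h4 _ Hz; rewrite !sat_impE => /(_ zk).
  rewrite sat_notE !sat_leE; exact.
rewrite !sat_impE sat_notE !sat_leE; exact: h4.
Qed.

Definition sat_succE e x y w k := propext (sat_succ e x y w k).

Lemma sat_inter e x k g : H_omega2 (nth empty e x) -> H_omega2 (nth empty e k) ->
  sat e (FInter x k g) <-> nth empty e x = vinter (nth empty e k) (nth empty e g).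
Proof.
move=> Hx Hk; rewrite /FInter sat_allE; split=> [h|h z Hz].
  apply: vextP => z; rewrite vinterE; split=> hz.
    by have := h _ (H_mem Hx hz); rewrite sat_andE !sat_impE => -[+ _]; exact.
  by have := h _ (H_mem Hk hz.1); rewrite sat_andE !sat_impE => -[_]; exact.
by rewrite sat_andE !sat_impE /= h vinterE.
Qed.

Lemma pi_H a : vmem a omega2 -> H_omega2 (pi a).
Proof. by case: pi_bij => + _ _ ao; apply. Qed.

Lemma pi_surj x : H_omega2 x -> exists2 a, vmem a omega2 & pi a = x.
Proof. by case: pi_bij => _ _ + Hx => /(_ x Hx)[a ao <-]; exists a. Qed.

Lemma pi_inj a b : vmem a omega2 -> vmem b omega2 -> pi a = pi b -> a = b.
Proof. by case: pi_bij => _ pi_i _ ao bo; apply: pi_i; rewrite inE. Qed.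

Lemma omega2_gt0 : vmem empty omega2.
Proof.
have [oo n2 _] := omega2P; have [x xo] : exists x, vmem x omega2.
  apply: contrapT => n; apply: n2; suff -> : elts omega2 = set0.
    exact/countable_le1/countable0.
  by rewrite -subset0 => x xo; apply: n; exists x.
have [y [yo oy ymin]] := @ord_least (elts omega2) (ex_intro2 _ _ x xo (ord_mem xo oo)).
suff <- : y = empty by [].
apply: vextP => z; split=> [zy|/vmem_empty//].
by have := ole_notlt (ymin z (ord_mem zy oy) (ord_trans zy yo oo)).
Qed.

Lemma Y_H a : Y a -> H_omega2 a.
Proof.
move=> /YP[ao ca]; apply: H_set; first exact: countable_le1.
by move=> x /ao; exact: H_ord.
Qed.

Lemma skolem_H phi e : H_omega2 (skolem phi e).
Proof.
rewrite /Defs.skolem; apply: pi_H; case: xgetP => [a _ []//|_]; exact: omega2_gt0.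
Qed.

Lemma skolemP phi e : (exists2 x, H_omega2 x & sat (x :: e) phi) ->
  sat (skolem phi e :: e) phi.
Proof.
move=> [x /pi_surj[a ao <-] sa]; rewrite /Defs.skolem.
case: xgetP => [b _ []//|].
have [b [[bo sb] ob bmin]] := @ord_least [set b | vmem b omega2 /\ sat (pi b :: e) phi]
  (ex_intro2 _ _ a (conj ao sa) (ord_mem ao ord_omega2)).
move=> /(_ b)[]; split=> // c cb sc.
apply: (ole_notlt (bmin c (ord_mem cb ob) _) cb).
by split=> //; exact: (ord_trans cb bo ord_omega2).
Qed.

Lemma Sk_sub a : a `<=` Sk a.
Proof. by move=> x ax S [/(_ x ax)]. Qed.

Lemma Sk_closed a : skolem_closed pi Y (Sk a).
Proof. by move=> phi e ae S [aS cS]; apply: (cS) => x xe; exact: (ae x xe S (conj aS cS)). Qed.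

Lemma Sk_min a S : a `<=` S -> skolem_closed pi Y S -> Sk a `<=` S.
Proof. by move=> aS cS x; apply; split. Qed.

Lemma Sk_mono a b : a `<=` b -> Sk a `<=` Sk b.
Proof. by move=> ab; apply: Sk_min; [exact: subset_trans ab (@Sk_sub b)|exact: Sk_closed]. Qed.

Lemma Sk_H a : a `<=` H_omega2 -> Sk a `<=` H_omega2.
Proof. by move=> aH; apply: Sk_min => // phi e _; exact: skolem_H. Qed.

(** The Tarski-Vaught property. Membership in a hull is obtained from it by a formula that either
    determines the object or accepts any suitable witness. *)
Lemma Sk_TV a phi e : (forall x, x \in e -> Sk a x) ->
  (exists2 x, H_omega2 x & sat (x :: e) phi) ->
  exists x, [/\ Sk a x, H_omega2 x & sat (x :: e) phi].
Proof.
move=> ae h; exists (skolem phi e).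
by split; [exact: Sk_closed|exact: skolem_H|exact: skolemP].
Qed.

Lemma Sk_pi a i : vmem i omega2 -> Sk a (pi i) <-> Sk a i.
Proof.
move=> io; split=> h.
  have [||j [aj _ /= [jo ij]]] := @Sk_TV a (FPi 0 1) [:: pi i].
  - by move=> x; rewrite inE => /eqP->.
  - by exists i => //; exact: H_ord.
  by rewrite -(pi_inj jo io ij).
have [||x [ax _ /= [_ ->]]] // := @Sk_TV a (FPi 1 0) [:: i].
- by move=> x; rewrite inE => /eqP->.
- by exists (pi i) => //; exact: pi_H.
Qed.

Lemma in_seq2 (P : V -> Prop) x y : P x -> P y -> forall z, z \in [:: x; y] -> P z.
Proof. by move=> Px Py z; rewrite !inE => /orP[]/eqP->. Qed.

Lemma Sk_inter a k g : H_omega2 k -> Sk a k -> Sk a g -> Sk a (vinter k g).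
Proof.
move=> Hk ak ag; have Hi : H_omega2 (vinter k g).
  by apply: H_sub Hk _ => x /vinterE[].
have [||x [ax Hx]] := @Sk_TV a (FInter 0 1 2) [:: k; g].
- exact: in_seq2.
- by exists (vinter k g) => //; exact/sat_inter.
by rewrite sat_inter //= => <-.
Qed.

(** There are at most omega_1 traces on [g], so their codes under [pi] are bounded below omega_2.
    Being such a bound is first-order in [g], so the hull contains one. *)
Lemma Sk_thin a g : thin Y -> vmem g omega2 -> Sk a g ->
  exists d, [/\ vmem d omega2, Sk a d &
    forall k, Y k -> exists2 i, vmem i d & pi i = vinter k g].
Proof.
move=> tY go ag.
have HI k : Y k -> H_omega2 (vinter k g).
  by move=> /Y_H Hk; apply: H_sub Hk _ => x /vinterE[].
(* Variable 0 is [d] and variable 1 is [g]. The first conjunct says that [d] is below omega_2: the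
   domain condition inside [FPi] expresses this without omega_2 as a parameter. *)
pose phi := FAnd (FEx (FPi 1 0)) (FAll (FImp (FY 0) (FEx (FAnd (FMem 0 2)
  (FEx (FAnd (FPi 1 0) (FInter 0 2 4))))))).
have satphi d : H_omega2 d -> sat [:: d; g] phi <-> vmem d omega2 /\
    forall k, Y k -> exists2 i, vmem i d & pi i = vinter k g.
  move=> Hd; have -> : sat [:: d; g] phi <-> (exists2 x, H_omega2 x &
      vmem d omega2 /\ pi d = x) /\ sat [:: d; g] (FAll (FImp (FY 0) (FEx (FAnd (FMem 0 2)
      (FEx (FAnd (FPi 1 0) (FInter 0 2 4))))))) by [].
  rewrite sat_allE; split=> -[].
    move=> [_ _ [dO _]] h; split=> // k Yk; have Hk := Y_H Yk.
    have /sat_imp/(_ Yk) [i Hi [id0 [x Hx [[_ ix] xi]]]] := h k Hk.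
    by exists i => //; rewrite ix; exact: ((@sat_inter [:: x; i; k; d; g] 0 2 4 Hx Hk).1 xi).
  move=> dO h; split; first by exists (pi d) => //; exact: pi_H.
  move=> k Hk; apply/sat_imp => Yk; have [i id0 ik] := h k Yk.
  have io : vmem i omega2 by exact: (ord_trans id0 dO ord_omega2).
  exists i; first exact: H_ord.
  split=> //; exists (pi i); first exact: pi_H.
  by split=> //; apply: (@sat_inter [:: pi i; i; k; d; g] 0 2 4 _ Hk).2 => //; exact: pi_H.
have [||d [ad Hd]] := @Sk_TV a phi [:: g].
- by move=> x; rewrite inE => /eqP->.
- have /choice[inv invP] x : exists i, H_omega2 x -> vmem i omega2 /\ pi i = x.
    case: (pselect (H_omega2 x)) => [/pi_surj[i]|]; last by exists empty.
    by exists i.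
  have [||d dO dP] := @omega2_bounded (inv @` ((fun k => vinter k g) @` Y)).
  + by move=> _ [_ [k Yk <-] <-]; have [] := invP _ (HI _ Yk).
  + by apply: le1_image; exact: tY.
  exists d; first exact: H_ord.
  apply/satphi; first exact: H_ord.
  split=> // k Yk; exists (inv (vinter k g)); last by have [] := invP _ (HI _ Yk).
  by apply: dP; exists (vinter k g) => //; exists k.
by rewrite satphi // => -[dO dP]; exists d.
Qed.

(* k is enumerated along the order of type at most omega induced by the family
   of its initial segments, and each element is definable from the previous one. *)
Lemma Sk_countable a k : H_omega2 k -> countable (elts k) -> Sk a k ->
  elts k `<=` Sk a.
Proof.
move=> Hk /(card_leE 0%N)[g [_ gi]] ak.
case: (pselect (exists x, vmem x k)) => [[u uk]|nk]; last first.
  by move=> x xk; case: nk; exists x.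
have kH x : vmem x k -> H_omega2 x by exact: H_mem.
have {uk u} [x0 [x0k x0min]] : exists x0, vmem x0 k /\
    forall x, vmem x k -> (g x0 <= g x)%N.
  have ex : exists n, `[< exists2 x, vmem x k & g x = n >].
    by exists (g u); apply/asboolP; exists u.
  case: (ex_minnP ex) => n /asboolP[x xk <-] nmin; exists x; split=> // y yk.
  by apply: nmin; apply/asboolP; exists y.
(* Variables 0, 1, 2 are [w], the start [x] and [k]. The conjuncts: [x] is in [k], successors are
   unique, and a set containing [x] and closed under successors contains [k]. *)
pose phi := FAnd (FMem 1 2) (FAnd
  (FAll (FAll (FAll (FImp (FSucc 2 1 3 5) (FImp (FSucc 2 0 3 5) (FEq 1 0))))))
  (FAll (FImp (FMem 2 0) (FImp
    (FAll (FAll (FImp (FMem 1 2) (FImp (FSucc 1 0 3 5) (FMem 0 2)))))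
    (FAll (FImp (FMem 0 4) (FMem 0 1))))))).
have satphi w x : sat [:: w; x; k] phi <-> [/\ vmem x k,
   forall y z z', succW w k y z -> succW w k y z' -> z = z' &
   forall Z, H_omega2 Z -> vmem x Z ->
     (forall y z, vmem y Z -> succW w k y z -> vmem z Z) -> vsub k Z].
  rewrite /phi 2!sat_andE 2!sat_allE.
  apply: and3_iff.
  - split=> h y.
      move=> z z' yz yz'; have [? ? _ _] := yz; have [_ ? _ _] := yz'.
      have := h y (kH _ _); rewrite sat_allE => /(_ _ z (kH _ _)).
      rewrite sat_allE => /(_ _ _ z' (kH _ _)); rewrite !sat_impE !sat_succE /=; exact.
    move=> _; apply/sat_all => z _; apply/sat_all => z' _.
    by rewrite !sat_impE !sat_succE /=; exact: h.
  split=> h Z HZ.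
    move=> xZ Zc z zk.
    have zc : sat [:: Z; w; x; k]
        (FAll (FAll (FImp (FMem 1 2) (FImp (FSucc 1 0 3 5) (FMem 0 2))))).
      apply/sat_all => y _; apply/sat_all => y' _; rewrite !sat_impE sat_succE; exact: Zc.
    have := h Z HZ; rewrite !sat_impE => /(_ xZ zc); rewrite sat_allE => /(_ z (kH _ zk)).
    by rewrite sat_impE; exact.
  rewrite !sat_impE => xZ; rewrite sat_allE => Zc; apply/sat_all => z _.
  apply/sat_imp => zk; apply: (h Z HZ xZ) zk => y y' yZ yy'.
  have [yk y'k _ _] := yy'; have := Zc y (kH _ yk).
  by rewrite sat_allE => /(_ y' (kH _ y'k)); rewrite !sat_impE sat_succE /=; apply.
pose I y := mkset [set x | vmem x k /\ (g x <= g y)%N].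
have IE x y : vmem x (I y) <-> vmem x k /\ (g x <= g y)%N.
  by apply: mksetP; apply: (@small_sub _ k) => z [].
have HI y : H_omega2 (I y) by apply: H_sub Hk _ => x /IE[].
have sI : is_small (I @` elts k) by apply: small_image; exists k.
pose w := mkset (I @` elts k).
have wE J : vmem J w <-> exists2 y, vmem y k & I y = J.
  exact: mksetP.
have Hw : H_omega2 w.
  apply: H_set; rewrite /w elts_mksetE //; last by move=> _ [y _ <-].
  apply: le1_image; apply: (@le1_inj _ _ _ _ g _ gi nat_le1) => //.
have leE x y : vmem x k -> vmem y k -> leW w x y <-> (g x <= g y)%N.
  move=> xk yk; split=> [h|xy J _ /wE[z zk <-] /IE[_ yz]].
    by have /IE[] : vmem x (I y) by apply: h => //; [apply/wE; exists y|apply/IE].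
  by apply/IE; split=> //; exact: leq_trans yz.
have sw : sat [:: w; x0; k] phi.
  apply/satphi; split=> // [y z z'|Z HZ x0Z Zc].
    move=> [yk zk nzy zmin] [_ z'k nz'y z'min]; apply: gi => //; apply/eqP.
    rewrite eqn_leq; apply/andP; split; apply/leE => //.
      by apply: zmin => //; exact: kH.
    by apply: z'min => //; exact: kH.
  suff ind n z : (g z < n)%N -> vmem z k -> vmem z Z by move=> z; exact: (ind (g z).+1).
  elim: n z => // n IH z zn zk; case: (ltnP (g x0) (g z)) => x0z; last first.
    by rewrite (gi z x0) //; apply/eqP; rewrite eqn_leq x0z x0min.
  (* The predecessor of [z] is the element of [k] with the largest value of [g] below [g z]; [g x0]
     shows that such values exist. *)
  pose P m := `[< exists2 y, vmem y k & g y = m >] && (m < g z)%N.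
  have exP : exists m, P m.
    by exists (g x0); rewrite /P x0z andbT; apply/asboolP; exists x0.
  have ubP m : P m -> (m <= g z)%N by move=> /andP[_ /ltnW].
  case: (ex_maxnP exP ubP) => m /andP[/asboolP[y yk <-] yz] ymax.
  apply: (Zc y); first by apply: IH => //; exact: leq_trans yz zn.
  split=> //; first by move=> /leE; rewrite leqNgt yz => /(_ zk yk).
  move=> t _ tk nty; apply/leE => //; rewrite leqNgt; apply/negP => tz.
  apply: nty; apply/leE => //; apply: ymax; apply/andP; split=> //.
  by apply/asboolP; exists t.
(* The hull chooses its own start and then its own family, possibly other than [x0] and [w]; only
   [phi] is known of them. *)
have [||x1 [ax1 Hx1 [w1 Hw1 sw1]]] := @Sk_TV a (FEx phi) [:: k].
- by move=> x; rewrite inE => /eqP->.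
- by exists x0; [exact: kH|exists w].
have [||w2 [aw2 Hw2]] := @Sk_TV a phi [:: x1; k].
- exact: in_seq2.
- by exists w1.
(* Induction is applied to the part [Z] of [k] inside the hull. [Z] only has to belong to
   [H_omega2], which it does as a subset of [k], and not to the hull. *)
move=> /satphi[x1k w2f w2i]; pose Z := mkset (elts k `&` Sk a).
have ZE z : vmem z Z <-> vmem z k /\ Sk a z.
  by apply: mksetP; apply: (@small_sub _ k) => t [].
have HZ : H_omega2 Z by apply: H_sub Hk _ => z /ZE[].
move=> x xk; have /ZE[] // : vmem x Z.
apply: (w2i Z HZ _ _ x xk) => [|y z /ZE[yk ay] yz]; first exact/ZE.
have [_ zk _ _] := yz; apply/ZE; split=> //.
have [||z' [az' _ /sat_succ /= yz']] := @Sk_TV a (FSucc 1 0 2 3) [:: y; w2; k].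
- by move=> t; rewrite !inE => /or3P[]/eqP->.
- by exists z; [exact: kH|apply/sat_succ].
by rewrite (w2f _ _ _ yz yz').
Qed.

End Skolem.

(** * Closure ordinals *)

Lemma countableU T (A B : set T) : countable A -> countable B -> countable (A `|` B).
Proof. by move=> cA cB; rewrite -bigcup2inE; apply: bigcup_countable => // -[|[|]]. Qed.

Lemma countable_image T U (f : T -> U) (A : set T) : countable A -> countable (f @` A).
Proof. by apply: sub_countable; exact: card_image_le. Qed.

Lemma countable_sub T (A B : set T) : A `<=` B -> countable B -> countable A.
Proof. by move=> /subset_card_le; exact: sub_countable. Qed.

Lemma omega2_trans a b : vmem a b -> vmem b omega2 -> vmem a omega2.
Proof. by move=> ab bo; exact: (ord_trans ab bo ord_omega2). Qed.

Lemma omega2_ord a : vmem a omega2 -> ordinal a.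
Proof. by move=> ao; exact: (ord_mem ao ord_omega2). Qed.

Lemma omega2_osup (S : set V) : S `<=` elts omega2 -> le1 S ->
  vmem (osup S) omega2 /\ forall x, S x -> ole x (osup S).
Proof.
move=> So S1; have [d dO dS] := omega2_bounded So S1.
have sS : is_small S by apply: (@small_sub _ d).
have oS y : S y -> ordinal y by move=> /So /omega2_ord.
split=> [|x Sx]; last exact: osup_ub.
apply: (ole_lt_trans _ dO ord_omega2); apply: osup_lub => //; first exact: omega2_ord.
by move=> y Sy; left; exact: dS.
Qed.

Lemma seq_chain (T : eqType) (S : nat -> set T) (e : seq T) :
  (forall n, S n `<=` S n.+1) -> (forall y, y \in e -> exists n, S n y) ->
  exists n, forall y, y \in e -> S n y.
Proof.
move=> Sn; have mono m n : (m <= n)%N -> S m `<=` S n.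
  elim: n => [|n IH]; first by rewrite leqn0 => /eqP->.
  by rewrite leq_eqVlt => /orP[/eqP->//|/IH h]; exact: subset_trans h (Sn n).
elim: e => [|x e IH] h; first by exists 0%N.
have [|n nP] := IH; first by move=> y ye; apply: h; rewrite inE ye orbT.
have [m mP] := h x (mem_head _ _); exists (maxn m n) => y; rewrite inE => /orP[/eqP->|/nP].
  exact: mono (leq_maxl _ _) _ mP.
exact: mono (leq_maxr _ _) _.
Qed.

(** [b] is the supremum of an omega-chain in which each term bounds chosen witnesses for all
    ordinals below the previous term. *)
Lemma omega2_reflect (Q : V -> V -> Prop) :
  (forall g, vmem g omega2 -> exists2 d, vmem d omega2 & Q g d) ->
  forall g, vmem g omega2 -> exists b, [/\ vmem b omega2, vmem g b &
    forall x, vmem x b -> exists2 d, vmem d b & Q x d].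
Proof.
move=> QP g go.
have /choice[d dP] x : exists d, vmem x omega2 -> vmem d omega2 /\ Q x d.
  case: (pselect (vmem x omega2)) => [/QP[d]|]; last by exists empty.
  by exists d.
have /choice[s sP] b : exists b', vmem b omega2 ->
    [/\ vmem b' omega2, vmem b b' & forall x, vmem x b -> vmem (d x) b'].
  case: (pselect (vmem b omega2)) => bo; last by exists empty.
  have [||b' b'o h] := @omega2_bounded ([set b] `|` d @` elts b).
  - by move=> _ [->//|[x xb <-]]; have [] := dP _ (omega2_trans xb bo).
  - apply: le1U; first exact/countable_le1/countable1.
    by apply: le1_image; have [_ _] := omega2P; apply.
  by exists b' => _; split=> // [|x xb]; apply: h; [left|right; exists x].
pose B n := iter n s (osucc g).
have Bo n : vmem (B n) omega2.
  by elim: n => [|n /sP[]//]; exact: omega2_succ.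
pose b := osup (range B).
have [bo Bb] : vmem b omega2 /\ forall x, range B x -> ole x b.
  apply: omega2_osup; first by move=> _ [n _ <-]; exact: Bo.
  by apply: le1_image; exact: nat_le1.
have sB : is_small (range B) by apply: small_countable; exact/countable_image/countableP.
have Bb' n : vmem (B n) b.
  apply/osupE => //; exists (B n.+1); first by exists n.+1.
  by have [] := sP _ (Bo n).
exists b; split=> //.
  by apply/osupE => //; exists (B 0%N); [exists 0%N|apply/osuccE; right].
move=> x /(osupE _ sB)[_ [n _ <-] xn]; have [_ _ /(_ _ xn) dn] := sP _ (Bo n).
exists (d x); last by have [] := dP _ (omega2_trans xn (Bo n)).
exact: (ord_trans dn (Bb' n.+1) (omega2_ord bo)).
Qed.

Section Closure.
Variables (pi : V -> V) (Y : set V).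
Hypothesis pi_bij : set_bij (elts omega2) H_omega2 pi.

Local Notation Sk := (Sk pi Y).
Local Notation skolem := (skolem pi Y).
Local Notation C := (C pi Y).
Local Notation Lambda := (Lambda pi Y).
Local Notation X := (X pi Y).

(** The Skolem functions act on ordinals through their codes under [pi]. The clauses on [y] add the
    code of [y], the value [pi y] when it is an ordinal below omega_2, and the supremum required by
    [X]. *)
Definition hullstep (e : seq V) : set V := [set x | vmem x omega2 /\
  ((exists phi, pi x = skolem phi (map pi e)) \/
   exists2 y, y \in e & [\/ pi x = y, x = pi y | x = osup (C `&` elts y)])].

Definition hull_closed (a : set V) :=
  forall e, (forall y, y \in e -> a y) -> hullstep e `<=` a.

Lemma countable_hullstep e : countable (hullstep e).
Proof.
have /choice[inv invP] x : exists i, forall j, vmem j omega2 -> pi j = x -> j = i.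
  case: (pselect (exists2 j, vmem j omega2 & pi j = x)) => [[j jo <-]|n].
    by exists j => k ko /(pi_inj pi_bij ko jo).
  by exists empty => j jo jx; case: n; exists j.
apply: (@countable_sub _ _ ((fun phi => inv (skolem phi (map pi e))) @` setT `|`
  (inv @` [set` e] `|` (pi @` [set` e] `|` (fun y => osup (C `&` elts y)) @` [set` e])))).
  move=> x [xo [[phi px]|[y ye [px|->|->]]]].
  - by left; exists phi => //; rewrite (invP _ _ xo px).
  - by right; left; exists y => //; rewrite (invP _ _ xo px).
  - by right; right; left; exists y.
  - by right; right; right; exists y.
have ce : countable [set` e] by apply: finite_set_countable; exact: finite_seq.
by do 3 (apply: countableU; first by apply: countable_image => //; exact: countable_formula);
  exact: countable_image.
Qed.

Lemma hull_closed_seq (a : set V) e :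
  (forall x, x \in e -> (pi @` a) x) -> exists2 e', e = map pi e' & forall y, y \in e' -> a y.
Proof.
elim: e => [|x e IH] h; first by exists [::].
have [y ay yx] := h x (mem_head _ _).
have [|e' -> e'a] := IH; first by move=> z ze; apply: h; rewrite inE ze orbT.
by exists (y :: e') => [|z]; [rewrite /= yx|rewrite inE => /orP[/eqP->//|/e'a]].
Qed.

(** The image of [a] under [pi] contains [a] and is closed under the Skolem functions, so it
    contains the hull; its elements below omega_2 are back in [a]. *)
Lemma hull_closed_Sk (a : set V) : a `<=` elts omega2 -> hull_closed a ->
  Sk a `&` elts omega2 = a.
Proof.
move=> ao ca; have one (Q : V -> Prop) y : Q y -> forall z, z \in [:: y] -> Q z.
  by move=> Qy z; rewrite inE => /eqP->.
have sub : Sk a `<=` pi @` a.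
  apply: Sk_min => [x ax|phi e /hull_closed_seq[e' -> e'a]].
    have [i io ix] := pi_surj pi_bij (H_ord (ao _ ax)); exists i => //.
    apply: (ca [:: x]); first exact: one.
    by split=> //; right; exists x; [exact: mem_head|exact: Or31].
  have [i io ix] := pi_surj pi_bij (@skolem_H pi Y pi_bij phi (map pi e')); exists i => //.
  by apply: (ca e') => //; split=> //; left; exists phi.
rewrite predeqE => x; split=> [[/sub[y ay <-] xo]|ax]; last first.
  by split; [exact: Sk_sub|exact: ao].
apply: (ca [:: y]); first exact: one.
by split=> //; right; exists y; [exact: mem_head|exact: Or32].
Qed.

Lemma osupC_le y : vmem y omega2 ->
  vmem (osup (C `&` elts y)) omega2 /\ ole (osup (C `&` elts y)) y.
Proof.
move=> yo; have sS : is_small (C `&` elts y) by apply: (@small_sub _ y) => z [].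
have h : ole (osup (C `&` elts y)) y.
  apply: osup_lub => // [z [_ zy]||z [_ zy]]; [|exact: omega2_ord|by left].
  exact: (ord_mem zy (omega2_ord yo)).
by split=> //; exact: (ole_lt_trans h yo ord_omega2).
Qed.

Lemma hull_closed_osupC (a : set V) y : a `<=` elts omega2 -> hull_closed a ->
  a y -> a (osup (C `&` elts y)).
Proof.
move=> ao ca ay; apply: (ca [:: y]); first by move=> z; rewrite inE => /eqP->.
have [h _] := osupC_le (ao _ ay).
by split=> //; right; exists y; [exact: mem_head|exact: Or33].
Qed.

(** There are at most omega_1 finite sequences from [osucc g], and each contributes a countable
    set. *)
Lemma hull_bound g : vmem g omega2 -> exists2 d, vmem d omega2 &
  forall e, (forall y, y \in e -> vmem y (osucc g)) -> hullstep e `<=` elts d.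
Proof.
move=> go; have [||d dO dP] := @omega2_bounded
    (\bigcup_(e in [set e : seq V | forall y, y \in e -> vmem y (osucc g)]) hullstep e).
- by move=> x [e _ []].
- apply: le1_bigcup => [|e _]; last exact/countable_le1/countable_hullstep.
  by apply: le1_seq; have [_ _] := omega2P; apply; exact: omega2_succ.
by exists d => // e eg x ex; apply: dP; exists e.
Qed.

Lemma hull_closed_ord b : vmem b omega2 -> (exists x, vmem x b) ->
  (forall g, vmem g b -> exists2 d, vmem d b & forall e,
    (forall y, y \in e -> vmem y (osucc g)) -> hullstep e `<=` elts d) ->
  hull_closed (elts b).
Proof.
move=> bo [x xb] h e eb; have ob := omega2_ord bo.
have [g gb eg] : exists2 g, vmem g b & forall y, y \in e -> vmem y (osucc g).
  elim: e eb => [|y e IH] eb; first by exists x.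
  have [|g gb eg] := IH; first by move=> z ze; apply: eb; rewrite inE ze orbT.
  have yb := eb y (mem_head _ _).
  have oy := ord_mem yb ob; have og := ord_mem gb ob.
  case: (pselect (vmem g y)) => [gy|/(ord_leP oy og) yg].
    exists y => // z; rewrite inE => /orP[/eqP->|/eg /osuccE zg].
      by apply/osuccE; right.
    by apply/osuccE; left; exact: (ole_lt_trans zg gy oy).
  by exists g => // z; rewrite inE => /orP[/eqP->|/eg //]; exact/osuccE.
have [d db /(_ e eg) ed] := h g gb.
by move=> z /ed zd; exact: (ord_trans zd db ob).
Qed.

Lemma hull_closed_C b : vmem b omega2 -> hull_closed (elts b) -> C b.
Proof.
by move=> bo cb; split=> //; apply: hull_closed_Sk => // x xb; exact: (omega2_trans xb bo).
Qed.

Lemma C_Sk b x : C b -> Sk (elts b) x -> exists2 i, vmem i b & pi i = x.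
Proof.
move=> [bo Cb] bx; have [i io ix] : exists2 i, vmem i omega2 & pi i = x.
  apply: (pi_surj pi_bij); apply: (Sk_H pi_bij) bx => y yb.
  by apply: H_ord; exact: (omega2_trans yb bo).
exists i => //; rewrite -[vmem i b]/(elts b i) -Cb; split=> //.
by apply/(Sk_pi Y pi_bij _ io); rewrite ix.
Qed.

(** If [S] were unbounded, countably many indices of the cofinal map [f] would dominate it. They
    have a bound [a] below omega_1, and [f] restricted to [a] would still be cofinal. *)
Lemma Lambda_bounded b (S : set V) : Lambda b -> countable S -> S `<=` elts b ->
  exists2 g, vmem g b & S `<=` elts g.
Proof.
move=> [bo [o1 [f [fm fc]] nc] lim] cS Sb; have ob := omega2_ord bo.
have [oo _ _] := omega1P.
apply: contrapT => n.
have /choice[d dP] k : exists d, S k -> vmem d omega1 /\ ole k (f d).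
  case: (pselect (S k)) => [/Sb/fc[d d1 kd]|]; last by exists empty.
  by exists d.
have [||a ao da] := @omega1_bounded (d @` S).
- by move=> _ [k /dP[] ? _ <-].
- exact: countable_image.
apply: (nc a ao); exists f; split.
  by move=> x xa; apply: fm; exact: (ord_trans xa ao oo).
move=> c cb; have [k Sk ck] : exists2 k, S k & ole c k.
  apply: contrapT => n'; apply: n; exists c => // k Sk.
  apply: contrapT => kc; apply: n'; exists k => //.
  by apply: ord_leP => //; [exact: (ord_mem cb ob)|exact: (ord_mem (Sb _ Sk) ob)].
have [_ kd] := dP _ Sk; exists (d k); first by apply: da; exists k.
apply: (ole_trans ck kd); apply: (ord_mem _ ob); apply: fm.
by have [] := dP _ Sk.
Qed.

(** The supremum of a strictly increasing omega_1-chain of closure points is again a closure point,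
    is a limit of [C], and has cofinality omega_1. *)
Lemma Lambda_reflect (Q : V -> V -> Prop) :
  (forall g, vmem g omega2 -> exists2 d, vmem d omega2 & Q g d) ->
  forall g, vmem g omega2 -> exists b, [/\ Lambda b, vmem g b, hull_closed (elts b) &
    forall x, vmem x b -> exists2 d, vmem d b & Q x d].
Proof.
move=> QP g go; have [oo nc co] := omega1P.
pose Qh x d := forall e, (forall y, y \in e -> vmem y (osucc x)) -> hullstep e `<=` elts d.
(* [Q] need not be monotone in its second argument, unlike [Qh]; hence a separate witness [d'] at or
   below the common bound [d]. *)
pose Q' x d := Qh x d /\ exists2 d', ole d' d & Q x d'.
have Q'P x : vmem x omega2 -> exists2 d, vmem d omega2 & Q' x d.
  move=> xo; have [d1 d1o d1P] := hull_bound xo; have [d2 d2o d2P] := QP x xo.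
  have od1 := omega2_ord d1o; have od2 := omega2_ord d2o.
  case: (pselect (vmem d1 d2)) => [d12|/(ord_leP od2 od1) d21].
    exists d2 => //; split; last by exists d2 => //; right.
    by move=> e ex y /(d1P e ex) yd; exact: (ord_trans yd d12 od2).
  by exists d1 => //; split=> //; exists d2.
pose D b := vmem b omega2 /\ forall x, vmem x b -> exists2 d, vmem d b & Q' x d.
have DC b x : D b -> vmem x b -> C b /\ hull_closed (elts b).
  move=> [bo bD] xb; have h : hull_closed (elts b).
    apply: hull_closed_ord => //; first by exists x.
    by move=> y /bD[d db [dQ _]]; exists d.
  by split=> //; exact: hull_closed_C.
have /choice[s sP] (S : set V) : exists b, S `<=` elts omega2 -> le1 S ->
    [/\ D b, vmem g b & S `<=` elts b].
  case: (pselect (S `<=` elts omega2)) => So; last by exists empty.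
  case: (pselect (le1 S)) => S1; last by exists empty.
  have [||d dO dS] := @omega2_bounded (g |` S).
  - by move=> x [->//|/So].
  - by apply: le1U => //; exact/countable_le1/countable1.
  have [b [bo db bQ]] := omega2_reflect Q'P dO.
  exists b => _ _; split=> //; first by apply: (ord_trans (dS _ _) db (omega2_ord bo)); left.
  by move=> x Sx; apply: (ord_trans (dS _ _) db (omega2_ord bo)); right.
have [f fE] := wf_rec (fun i F => s (F @` elts i)) empty.
have fP i : vmem i omega1 -> [/\ D (f i), vmem g (f i) &
    forall j, vmem j i -> vmem (f j) (f i)].
  elim/vmem_ind: i => i IH io; rewrite [f i]fE; set S := _ @` _.
  have SE : S = f @` elts i.
    by rewrite /S predeqE => x; split=> -[j ji <-]; exists j => //; rewrite asboolT.
  have [||? ? Ss] := sP S.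
  - by rewrite SE => _ [j ji <-]; have [[]] := IH j ji (ord_trans ji io oo).
  - by rewrite SE; apply/le1_image/countable_le1/co.
  by split=> // j ji; apply: Ss; rewrite SE; exists j.
have [||bo _] := @omega2_osup (f @` elts omega1).
- by move=> _ [i /fP[[fio _] _ _] <-].
- exact/le1_image/card_lexx.
set b := osup _ in bo.
have ob := omega2_ord bo.
have sf : is_small (f @` elts omega1) by apply: small_image; exists omega1.
have bE x : vmem x b <-> exists2 i, vmem i omega1 & vmem x (f i).
  split=> [/(osupE _ sf)[_ [i io <-] xi]|[i io xi]]; first by exists i.
  by apply/(osupE _ sf); exists (f i) => //; exists i.
have next i : vmem i omega1 -> exists2 j, vmem j omega1 & vmem i j.
  move=> io; have [||j jo ij] := @omega1_bounded [set i].
  - by move=> _ ->. - exact: countable1.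
  by exists j => //; exact: ij.
have fb' i : vmem i omega1 -> vmem (f i) b.
  move=> io; have [j jo ij] := next i io; apply/bE; exists j => //.
  by have [_ _] := fP j jo; apply.
have [i0 i0o] := omega1_gt0; have [[D0 D0'] g0 _] := fP _ i0o.
have gb : vmem g b by apply/bE; exists i0.
have Db : D b.
  split=> // x /bE[i io xi]; have [[_ /(_ x xi)[d di dQ]] _ _] := fP i io.
  by exists d => //; apply/bE; exists i.
have [Cb hb] := DC b g Db gb.
exists b; split=> //; last first.
  move=> x /(Db.2)[d db [_ [d' d'd Qd']]]; exists d' => //.
  exact: (ole_lt_trans d'd db ob).
split=> //; last first.
  split=> [b0|c /bE[i io ci]]; first by move: gb; rewrite b0 => /vmem_empty.
  by exists (f i); split=> //; [have [Di _ _] := fP i io; have [] := DC _ _ Di ci|exact: fb'].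
split=> //.
  exists f; split=> [i io|c /bE[i io ci]]; first exact: fb'.
  by exists i => //; left.
(* No shorter map is cofinal: each [h x] lies below some [f (d x)], the countably many indices [d x]
   have a bound [j] below omega_1, and so [h] never reaches [f j]. *)
move=> a ao [h [hm hc]].
have /choice[d dP] x : exists d, vmem x a -> vmem d omega1 /\ vmem (h x) (f d).
  case: (pselect (vmem x a)) => [/hm/bE[d d1 kd]|]; last by exists empty.
  by exists d.
have [||j jo dj] := @omega1_bounded (d @` elts a).
- by move=> _ [k /dP[] ? _ <-].
- by apply: countable_image; exact: co.
have [x xa jx] := hc _ (fb' j jo); have [dxo hd] := dP x xa.
have dxj : vmem (d x) j by apply: dj; exists x.
have [_ _ /(_ _ dxj) fdj] := fP j jo.
have ofj : ordinal (f j) by have [[/omega2_ord]] := fP j jo.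
have := ole_notlt jx; apply; exact: (ord_trans hd fdj ofj).
Qed.

Lemma Lambda_unbounded g : vmem g omega2 -> exists2 b, Lambda b & vmem g b.
Proof.
move=> go; have [|b [Lb gb _ _]] := @Lambda_reflect (fun _ _ => True) _ g go.
  by move=> x xo; exists x.
by exists b.
Qed.

(** The countable hull-closed sets containing [a0] form a club, which the stationary [Y] meets. *)
Lemma X_exists (a0 : set V) : stationary_P Y -> countable a0 -> a0 `<=` elts omega2 ->
  exists2 M, X M & a0 `<=` elts M.
Proof.
move=> [_ sY] ca0 a0o.
pose D := [set a | [/\ Pomega1 a, a0 `<=` elts a & hull_closed (elts a)]].
have [|M [YM [[Mo cM] a0M hM]]] := sY D; last first.
  exists M => //; split=> //; first exact: hull_closed_Sk.
  by move=> c cM'; exact: (hull_closed_osupC Mo).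
split=> [a []//|a [ao ca]|c cD cmono]; last first.
  have cc : countable (\bigcup_n elts (c n)).
    by apply: bigcup_countable => // n _; have [[]] := cD n.
  have cE := elts_mksetE (small_countable cc).
  have cP x := mksetP x (small_countable cc).
  split; first split; last 2 first.
  - by move=> x ax; apply/cP; exists 0%N => //; have [_ + _] := cD 0%N; apply.
  - move=> e h x ex; apply/cP.
    have [|n nP] := seq_chain (S := fun n => elts (c n)) (e := e) cmono.
      by move=> y /h /cP[n _ cn]; exists n.
    by have [_ _ hn] := cD n; exists n => //; exact: (hn e nP).
  - by move=> x /cP[n _]; have [[+ _] _ _] := cD n; apply.
  by rewrite cE.
(* For unboundedness, [a] and [a0] are closed under [hullstep] in omega stages, each of which stays
   countable. *)
pose S := fix S n : set V := if n is n'.+1 then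
  S n' `|` \bigcup_(e in [set e : seq V | forall y, y \in e -> S n' y]) hullstep e
  else elts a `|` a0.
have So n : S n `<=` elts omega2.
  by elim: n => [|n IH] x [|]; [exact: ao|exact: a0o|exact: IH|move=> [e _ []]].
have cS n : countable (S n).
  elim: n => [|n IH]; apply: countableU => //.
  by apply: bigcup_countable => [|e _]; [exact: countable_seq|exact: countable_hullstep].
have cU : countable (\bigcup_n S n) by exact: bigcup_countable.
have cE := elts_mksetE (small_countable cU).
have cP x := mksetP x (small_countable cU).
exists (mkset (\bigcup_n S n)); last by move=> x xa; apply/cP; exists 0%N => //; left.
split; first split; last 2 first.
- by move=> x a0x; apply/cP; exists 0%N => //; right.
- move=> e h x ex; apply/cP; have [|y /h/cP[n _ Sn]|n nP] := seq_chain (S := S) (e := e).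
  + by move=> n y; left.
  + by exists n.
  by exists n.+1 => //; right; exists e.
- by move=> x /cP[n _] /So.
by rewrite cE.
Qed.

Lemma X_inter M b : initial_closed Y -> X M -> vmem b omega2 -> hull_closed (elts b) ->
  X (vinter M b).
Proof.
move=> iY [YM SM supM] bo hb.
have bo' : elts b `<=` elts omega2 by move=> x xb; exact: (omega2_trans xb bo).
have E x : elts (vinter M b) x <-> vmem x M /\ vmem x b by exact: vinterE.
split; first exact: iY.
  rewrite predeqE => x; split=> [[Sx xo]|xMb]; last first.
    by split; [exact: Sk_sub|apply: bo'; exact: ((E x).1 xMb).2].
  apply/E; split.
    rewrite -[vmem x M]/(elts M x) -SM; split=> //.
    by apply: Sk_mono Sx => y /E[].
  rewrite -[vmem x b]/(elts b x) -(hull_closed_Sk bo' hb); split=> //.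
  by apply: Sk_mono Sx => y /E[].
move=> c /E[cM cb]; apply/E; split; first exact: supM.
exact: (hull_closed_osupC bo' hb cb).
Qed.

End Closure.

(** * Comparison points and adequacy *)

Section Comparison.
Variables (pi : V -> V) (Y : set V).
Hypothesis pi_bij : set_bij (elts omega2) H_omega2 pi.
Hypothesis YP : Y `<=` Pomega1.

Local Notation Sk := (Sk pi Y).
Local Notation C := (C pi Y).
Local Notation Lambda := (Lambda pi Y).
Local Notation X := (X pi Y).
Local Notation Gamma_ := (Gamma_ Lambda).
Local Notation comparison := (comparison Lambda).

Lemma Lambda_ord b : Lambda b -> ordinal b.
Proof. by move=> [/omega2_ord]. Qed.

Lemma GammaP M b : Gamma_ M b <-> Lambda b /\
  forall c, Lambda c -> vmem c b -> exists m, [/\ vmem m M, vmem m b & vmem c m].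
Proof.
have supE c : vmem c (osup (elts (vinter M b))) <->
    exists m, [/\ vmem m M, vmem m b & vmem c m].
  rewrite osupE; last by exists (vinter M b).
  split=> [[m /vinterE[mM mb] cm]|[m [mM mb cm]]]; first by exists m.
  by exists m => //; apply/vinterE.
split=> [[Lb [_ bmin]]|[Lb h]].
  split=> // c Lc cb; apply/supE; apply: contrapT => nc.
  exact: (ole_notlt (bmin c (conj Lc nc)) cb).
have ob := Lambda_ord Lb.
split=> //; split.
  split=> // /supE[m [_ mb bm]]; exact: (vmem_asym mb bm).
move=> c [Lc nc]; apply: ord_leP => // [|cb]; first exact: Lambda_ord.
by apply: nc; apply/supE; exact: h.
Qed.

(** A point of [Gamma_] of the trace cannot exceed [b]: since [b] is in [Lambda], some element of
    the trace would lie above [b]. At points up to [b], [M] and its trace have the same elements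
    below. *)
Lemma Gamma_inter M b g : Lambda b ->
  Gamma_ (vinter M b) g <-> Gamma_ M g /\ ole g b.
Proof.
move=> Lb; have ob := Lambda_ord Lb; rewrite !GammaP; split.
  move=> [Lg h]; split; last first.
    apply: ord_leP => // [|bg]; first exact: Lambda_ord.
    by have [m [/vinterE[_ mb] _ bm]] := h b Lb bg; exact: (vmem_asym mb bm).
  by split=> // c Lc cg; have [m [/vinterE[mM _] mg cm]] := h c Lc cg; exists m.
move=> [[Lg h] gb]; split=> // c Lc cg; have [m [mM mg cm]] := h c Lc cg.
by exists m; split=> //; apply/vinterE; split=> //; exact: (lt_ole_trans mg gb ob).
Qed.

(** Without a maximum, each member of the intersection is exceeded by an element of [M], so a point
    of [Lambda] above [M] is not below the supremum. The least such point [b] of [Lambda] then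
    belongs to both sets and is the maximum after all. *)
Lemma comparison_max M N : vsub M omega2 -> countable (elts M) ->
  (Gamma_ M `&` Gamma_ N) !=set0 -> exists b, is_max (Gamma_ M `&` Gamma_ N) b.
Proof.
move=> Mo cM [s0 Ss0]; set S := _ `&` _ in Ss0 *; apply: contrapT => nomax.
have oS s : S s -> ordinal s by move=> [/GammaP[/Lambda_ord]].
have sS : is_small S by apply: (@small_sub _ omega2) => s [/GammaP[[]]].
have next s : S s -> exists2 s', S s' & vmem s s'.
  move=> Ss; apply: contrapT => n; apply: nomax; exists s; split=> // c Sc.
  by apply: ord_leP; [exact: oS|exact: oS|move=> sc; apply: n; exists c].
have [|mu muo Mmu] := @omega2_bounded (elts M) Mo; first exact: countable_le1.
have [b0 Lb0 mub0] := Lambda_unbounded Y pi_bij muo.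
have nb0 : ~ vmem b0 (osup S).
  move=> /(osupE _ sS)[s Ss b0s]; have [s' Ss' ss'] := next s Ss.
  have [Ls _] := (GammaP M s).1 Ss.1; have [_ h] := (GammaP M s').1 Ss'.1.
  have [m [mM _ sm]] := h s Ls ss'.
  apply: (@vmem_asym m b0); first exact: (ord_trans (Mmu _ mM) mub0 (Lambda_ord Lb0)).
  apply: (ord_trans b0s sm); exact: (omega2_ord (Mo _ mM)).
have [b [[Lb nb] ob bmin]] := @ord_least [set b | Lambda b /\ ~ vmem b (osup S)]
  (ex_intro2 _ _ b0 (conj Lb0 nb0) (Lambda_ord Lb0)).
have sb s : S s -> ole s b.
  move=> Ss; apply: ord_leP => //; first exact: oS.
  by move=> bs; apply: nb; apply/osupE => //; exists s.
(* A point [c] of [Lambda] below [b] is below some [s] in [S]. As [s] is itself in [Lambda], the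
   next member [s'] gives an element of [Z] above [s]. *)
have bG Z : (forall s, S s -> Gamma_ Z s) -> Gamma_ Z b.
  move=> SZ; apply/GammaP; split=> // c Lc cb.
  have : vmem c (osup S).
    apply: contrapT => nc; apply: (@ole_notlt b c _ cb).
    by apply: bmin => //; exact: Lambda_ord.
  move=> /(osupE _ sS)[s Ss cs]; have [s' Ss' ss'] := next s Ss.
  have [Ls _] := (GammaP Z s).1 (SZ _ Ss); have [_ h] := (GammaP Z s').1 (SZ _ Ss').
  have [m [mZ ms' sm]] := h s Ls ss'; exists m; split=> //.
    exact: (lt_ole_trans ms' (sb _ Ss') ob).
  exact: (ord_trans cs sm (ord_mem ms' (oS _ Ss'))).
apply: nomax; exists b; split=> //; split; apply: bG; by move=> s [].
Qed.

(** In the second case [xget] returned its default; both traces on [empty] are empty, so adequacy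
    holds there trivially. *)
Lemma comparisonP M N : vsub M omega2 -> countable (elts M) ->
  is_max (Gamma_ M `&` Gamma_ N) (comparison M N) \/
  comparison M N = empty /\ forall b, ~ (Gamma_ M `&` Gamma_ N) b.
Proof.
move=> Mo cM; rewrite /Defs.comparison.
case: xgetP => [b _ bP|nb]; first by left.
right; split=> // b Sb; have [|b' b'P] := @comparison_max M N Mo cM; first by exists b.
exact: nb b'P.
Qed.

Lemma comparison_ord M N : vsub M omega2 -> countable (elts M) ->
  ordinal (comparison M N).
Proof.
move=> Mo cM; have [[[/GammaP[/Lambda_ord//]]]|[-> _]] := comparisonP N Mo cM.
by split=> x /vmem_empty.
Qed.

Lemma vinter_empty a : vinter a empty = empty.
Proof. by apply: vextP => x; rewrite vinterE; split=> [[_]|/vmem_empty]. Qed.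

Lemma vinter_le M b b' : vsub b' b -> vinter (vinter M b) b' = vinter M b'.
Proof.
move=> b'b; apply: vextP => x; rewrite !vinterE; split=> [[[]]//|[xM xb']].
by split=> //; split=> //; exact: b'b.
Qed.

Definition adq (M N : V) : Prop :=
  let b := comparison M N in
  [\/ vinter M b = vinter N b, Sk (elts N) (vinter M b) | Sk (elts M) (vinter N b)].

Lemma adq_sym M N : adq M N -> adq N M.
Proof.
rewrite /adq; have -> : comparison N M = comparison M N.
  by rewrite /Defs.comparison setIC.
by move=> [->|h|h]; [exact: Or31|exact: Or33|exact: Or32].
Qed.

Lemma adq_refl M : adq M M.
Proof. exact: Or31. Qed.

Lemma X_Pomega1 M : X M -> vsub M omega2 /\ countable (elts M).
Proof. by move=> [/YP]. Qed.

Lemma X_H M : X M -> H_omega2 M.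
Proof. by move=> [/(Y_H YP)]. Qed.

(* An initial segment of P is P itself or is cut off at an element of P. *)
Lemma Sk_initial a P b : vsub P omega2 -> countable (elts P) -> ordinal b ->
  Sk a P -> Sk a (vinter P b).
Proof.
move=> Po cP ob aP; have HP' : H_omega2 P.
  by apply: H_set; [exact: countable_le1|move=> x /Po/H_ord].
case: (pselect (vsub P b)) => [Pb|nPb]; first by rewrite vinter_id.
have [x [xP nxb]] : exists x, vmem x P /\ ~ vmem x b.
  apply: contrapT => n; apply: nPb => x xP; apply: contrapT => nx; apply: n; by exists x.
have [p [[pP npb] op pmin]] := @ord_least [set p | vmem p P /\ ~ vmem p b]
  (ex_intro2 _ _ x (conj xP nxb) (omega2_ord (Po _ xP))).
have -> : vinter P b = vinter P p.
  apply: vextP => y; rewrite !vinterE; split=> -[yP h]; split=> //.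
    by apply: (lt_ole_trans h _ op); exact: ord_leP.
  apply: contrapT => nyb; apply: (@ole_notlt p y) => //.
  by apply: pmin => //; exact: (omega2_ord (Po _ yP)).
by apply: (Sk_inter pi_bij) => //; exact: (Sk_countable pi_bij HP' cP aP).
Qed.

(** The hull of [M] contains all initial segments of the countable set [K], whatever the comparison
    point is. *)
Lemma adq_of_Sk K M : X K -> Sk (elts M) K -> adq K M.
Proof.
move=> /X_Pomega1[Ko cK] MK; apply: Or32; apply: Sk_initial => //.
exact: comparison_ord.
Qed.

Lemma adq_inter_self M b : X M -> Lambda b -> adq M (vinter M b).
Proof.
move=> /X_Pomega1[Mo cM] Lb; apply: Or31.
have [[[_ /(Gamma_inter _ _ Lb)[_ cb]] _]|[-> _]] := comparisonP (vinter M b) Mo cM.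
  by rewrite vinter_le //; apply: ole_sub => //; exact: Lambda_ord.
by rewrite !vinter_empty.
Qed.

(** The trace on [b] is countable, so by cofinality omega_1 it is a trace on some [g] below [b]. The
    bound [d] from [Sk_thin] lies in the hull of [b], hence below [b], and so does the code of the
    trace. *)
Lemma Sk_Y_inter K b : thin Y -> C b -> Lambda b -> Y K -> Sk (elts b) (vinter K b).
Proof.
move=> tY Cb Lb YK; have ob := Lambda_ord Lb; have [bo _] := Cb.
have [Ko cK] := YP YK.
have [||g gb Kg] := @Lambda_bounded pi Y b (elts (vinter K b)) Lb.
- by apply: countable_sub cK => x /vinterE[].
- by move=> x /vinterE[].
have -> : vinter K b = vinter K g.
  apply: vextP => x; split=> [h|/vinterE[xK xg]]; last first.
    by apply/vinterE; split=> //; exact: (ord_trans xg gb ob).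
  by apply/vinterE; split; [have /vinterE[] := h|exact: Kg].
have go := omega2_trans gb bo.
have [d [dO bd dP]] := Sk_thin pi_bij YP tY go (@Sk_sub pi Y (elts b) g gb).
have db : vmem d b by have [_ bE] := Cb; rewrite -[vmem d b]/(elts b d) -bE.
have [i id0 <-] := dP K YK; have ib := ord_trans id0 db ob.
by apply/(Sk_pi Y pi_bij _ (omega2_trans ib bo)); exact: Sk_sub.
Qed.

(** [x] has a code below [b]. The code is also in the hull of [M], whose ordinals below omega_2 are
    those of [M]. *)
Lemma Sk_cap M b x : C b -> X M -> Sk (elts M) x -> Sk (elts b) x ->
  Sk (elts (vinter M b)) x.
Proof.
move=> Cb [YM SM _] Mx /(C_Sk pi_bij Cb)[i ib ix]; rewrite -ix in Mx *.
have io := omega2_trans ib Cb.1.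
apply/(Sk_pi Y pi_bij _ io); apply: Sk_sub; apply/vinterE; split=> //.
rewrite -[vmem i M]/(elts M i) -SM; split=> //; exact/(Sk_pi Y pi_bij _ io).
Qed.

(** By [Gamma_inter] the comparison point of the traces is at most both [b] and the old one, so each
    of the three alternatives passes to initial segments. *)
Lemma adq_inter M N b : thin Y -> C b -> Lambda b -> X M -> X N -> adq M N ->
  adq (vinter M b) (vinter N b).
Proof.
move=> tY Cb Lb XM XN; have ob := Lambda_ord Lb.
have [Mo cM] := X_Pomega1 XM; have [No cN] := X_Pomega1 XN.
have sub Z c : vsub (vinter Z c) Z by move=> x /vinterE[].
have Mbo : vsub (vinter M b) omega2 by apply: subset_trans Mo; exact: sub.
have cMb : countable (elts (vinter M b)) by apply: countable_sub cM; exact: sub.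
rewrite /adq; set c' := comparison (vinter M b) _.
have := comparisonP (vinter N b) Mbo cMb; rewrite -/c' => -[|[-> _]]; last first.
  by move=> _; rewrite !vinter_empty; exact: Or31.
move=> [[/(Gamma_inter _ _ Lb)[GM c'b] /(Gamma_inter _ _ Lb)[GN _]] _].
have c's : vsub c' b by exact: ole_sub.
have oc' : ordinal c' by have [/Lambda_ord] := (GammaP _ _).1 GM.
rewrite !(vinter_le _ c's); set c := comparison M N.
have := comparisonP N Mo cM; rewrite -/c => -[|[_ /(_ c')]]; last by case.
move=> [[/GammaP[/Lambda_ord oc _] _] /(_ c' (conj GM GN)) c'c].
have {c'c} c'c : vsub c' c by exact: ole_sub.
(* The trace of [Z] on [c'] is in the hull of [W], being an initial segment of the trace on [c], and
   in the hull of [b] by thinness; [Sk_cap] combines the two. *)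
have key Z W : X Z -> X W -> Sk (elts W) (vinter Z c) -> Sk (elts (vinter W b)) (vinter Z c').
  move=> XZ XW h; have [Zo cZ] := X_Pomega1 XZ.
  apply: Sk_cap => //.
    rewrite -(vinter_le _ c'c); apply: Sk_initial => //.
      by apply: subset_trans Zo; exact: sub.
    by apply: countable_sub cZ; exact: sub.
  rewrite -(vinter_le _ c's); apply: Sk_initial => //.
  - by apply: subset_trans Zo; exact: sub.
  - by apply: countable_sub cZ; exact: sub.
  by apply: Sk_Y_inter => //; have [] := XZ.
move=> [e|h|h].
- by apply: Or31; rewrite -(vinter_le M c'c) e vinter_le.
- by apply: Or32; exact: key.
- by apply: Or33; exact: key.
Qed.

(** As [L] is contained in [b], [Gamma_ L] has no point above [b]. Hence [K] and its trace have the
    same comparison point with [L], and the same elements below it. *)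
Lemma adq_lift K L b : Lambda b -> X K -> X L -> vsub L b ->
  adq (vinter K b) L -> adq K L.
Proof.
move=> Lb XK XL Lsb; have [Ko cK] := X_Pomega1 XK; have ob := Lambda_ord Lb.
have GE : Gamma_ (vinter K b) `&` Gamma_ L = Gamma_ K `&` Gamma_ L.
  rewrite predeqE => g; split=> -[].
    by move=> /(Gamma_inter _ _ Lb)[].
  move=> GK GL; split=> //; apply/(Gamma_inter _ _ Lb); split=> //.
  by move: GL; rewrite -{1}(vinter_id Lsb) => /(Gamma_inter _ _ Lb)[].
rewrite /adq; have -> : comparison (vinter K b) L = comparison K L.
  by rewrite /Defs.comparison GE.
have [|[-> _]] := comparisonP L Ko cK; last first.
  by move=> _; rewrite !vinter_empty; exact: Or31.
set c := comparison K L; rewrite -GE => -[[/(Gamma_inter _ _ Lb)[_ cb] _] _].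
rewrite vinter_le; last exact: ole_sub.
move=> [e|h|h]; [exact: Or31|exact: Or32|apply: Or33].
by apply: Sk_mono h => x /vinterE[].
Qed.

End Comparison.

(** * Amalgamation of conditions *)

Lemma le1_finite_subsets (T : eqType) (A : set T) : le1 A ->
  le1 [set F : set T | finite_set F /\ F `<=` A].
Proof.
move=> A1; apply: (@le1_sub _ _ ((fun s : seq T => [set` s]) @`
    [set s : seq T | forall x, x \in s -> A x])).
  by move=> _ [/finite_seqP[s ->] sA]; exists s.
exact/le1_image/le1_seq.
Qed.

Section Poset.
Variables (pi : V -> V) (Y : set V).
Hypothesis pi_bij : set_bij (elts omega2) H_omega2 pi.
Hypothesis Y_stationary : stationary_P Y.
Hypothesis Y_thin : thin Y.
Hypothesis Y_initial : initial_closed Y.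

Local Notation Sk := (Sk pi Y).
Local Notation C := (C pi Y).
Local Notation Lambda := (Lambda pi Y).
Local Notation X := (X pi Y).
Local Notation condition := (condition pi Y).
Local Notation adq := (adq pi Y).

Let YP : Y `<=` Pomega1. Proof. by case: Y_stationary. Qed.

(* The conditions in the hull of b, when b is in C. *)
Definition cond_in (b : V) (s : condition) :=
  (forall x y, fpart s (x, y) -> vmem x b /\ vmem y b) /\
  forall K, Apart s K -> exists2 i, vmem i b & pi i = K.

Lemma cond_eq (s t : condition) : fpart s = fpart t -> Apart s = Apart t -> s = t.
Proof.
case: s t => [f A f1 A1 A2 c1] [g B g1 B1 B2 c2] /= fg AB; subst g B.
by congr Condition; exact: Prop_irrelevance.
Qed.

Lemma cond_in_mono b c s : ordinal c -> ole b c -> cond_in b s -> cond_in c s.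
Proof.
move=> oc bc [s1 s2]; split=> [x y /s1[xb yb]|K /s2[i ib <-]].
  by split; [exact: (lt_ole_trans xb bc oc)|exact: (lt_ole_trans yb bc oc)].
by exists i => //; exact: (lt_ole_trans ib bc oc).
Qed.

(** Only finite sets of pairs and of codes below [b] are involved. The count is what bounds
    arbitrary functions on conditions. *)
Lemma le1_cond_in b : vmem b omega2 -> le1 [set s | cond_in b s].
Proof.
move=> bo; have b1 : le1 (elts b) by have [_ _] := omega2P; apply.
pose FF := [set F : set (V * V) | finite_set F /\ F `<=` elts b `*` elts b].
pose AA := [set F : set V | finite_set F /\ F `<=` pi @` elts b].
apply: (@le1_inj _ _ _ (FF `*` AA) (fun s => (fpart s, Apart s))).
- move=> s [s1 s2]; split; split=> /=.
  + by have [] := fpart_pfun s.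
  + by move=> [x y] /s1.
  + exact: Apart_fin.
  + by move=> K /s2[i ib <-]; exists i.
- by move=> s t _ _ [fst_eq snd_eq]; exact: cond_eq.
by apply: le1X; apply: le1_finite_subsets; [exact: le1X|exact: le1_image].
Qed.

Lemma cond_X (s : condition) K : Apart s K -> X K.
Proof. by move=> sK; have [+ _] := Apart_adequate s; apply. Qed.

Lemma cond_adq (s : condition) K L : Apart s K -> Apart s L -> adq K L.
Proof. by move=> sK sL; have [_] := Apart_adequate s; apply. Qed.

(** [S] collects the ordinals in [fpart] and the codes of the models. The condition is in the hull
    of an ordinal below omega_2 exactly when that ordinal contains [S]. *)
Lemma cond_support (s : condition) : exists S : set V, [/\ finite_set S,
  S `<=` elts omega2,
  forall x y, fpart s (x, y) -> S x /\ S y,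
  forall K, Apart s K -> exists2 i, S i & pi i = K &
  forall b, vmem b omega2 -> cond_in b s -> S `<=` elts b].
Proof.
have [ff fo _] := fpart_pfun s.
have /choice[inv invP] x : exists i, H_omega2 x -> vmem i omega2 /\ pi i = x.
  case: (pselect (H_omega2 x)) => [/(pi_surj pi_bij)[i]|]; last by exists empty.
  by exists i.
have AH K : Apart s K -> H_omega2 K by move=> /cond_X; exact: X_H.
exists (fst @` fpart s `|` (snd @` fpart s `|` inv @` Apart s)); split.
- rewrite finite_setU; split; first exact: finite_image.
  by rewrite finite_setU; split; apply: finite_image => //; exact: Apart_fin.
- by move=> x [[p /fo[? _] <-//]|[[p /fo[_ ?] <-//]|[K /AH/invP[? _] <-//]]].
- by move=> x y sxy; split; [left; exists (x, y)|right; left; exists (x, y)].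
- by move=> K sK; exists (inv K); [right; right; exists K|have [] := invP K (AH K sK)].
move=> b bo [s1 s2] x [[[u v] /s1[? _] <-//]|[[[u v] /s1[_ ?] <-//]|[K sK <-]]].
have [i ib iK] := s2 K sK; have [jo jK] := invP K (AH K sK).
by rewrite (pi_inj pi_bij jo (omega2_trans ib bo)) ?jK ?iK.
Qed.

Lemma cond_in_local b s x : Lambda b -> cond_in b s -> vmem x b ->
  exists g, [/\ vmem g b, cond_in (osucc g) s & vmem x (osucc g)].
Proof.
move=> Lb sb xb; have [bo _ _] := Lb.
have [S [Sf So S1 S2 Sb]] := cond_support s.
have [||g gb gS] := @Lambda_bounded pi Y b (x |` S) Lb.
- by apply: countableU; [exact: countable1|exact: finite_set_countable].
- by move=> y [->//|]; exact: Sb.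
have og := ord_mem gb (omega2_ord bo).
have gS' y : S y -> vmem y (osucc g) by move=> Sy; apply/osuccE; left; apply: gS; right.
exists g; split=> //; last by apply/osuccE; left; apply: gS; left.
split=> [u v /S1[Su Sv]|K /S2[i Si <-]]; first by split; exact: gS'.
by exists i => //; exact: gS'.
Qed.

Lemma cond_in_exists s : exists2 b, vmem b omega2 & cond_in b s.
Proof.
have [S [Sf So S1 S2 Sb]] := cond_support s.
have [|d dO dS] := @omega2_bounded S So; first exact/countable_le1/finite_set_countable.
exists d => //; split=> [u v /S1[Su Sv]|K /S2[i Si <-]]; first by split; exact: dS.
by exists i => //; exact: dS.
Qed.

(** [E] and [eta] are arbitrary: at most omega_1 arguments occur below [g]. The relation between [g]
    and [d] has the form that [Lambda_reflect] accepts. *)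
Lemma cond_in_bound (E : condition -> V -> condition) (eta : condition -> V -> V) :
  (forall s x, vmem (eta s x) omega2) ->
  forall g, vmem g omega2 -> exists2 d, vmem d omega2 & forall s x,
    cond_in (osucc g) s -> vmem x (osucc g) -> cond_in d (E s x) /\ vmem (eta s x) d.
Proof.
move=> etao g go; have sgo := omega2_succ go.
have /choice[d dP] (p : condition * V) : exists d, [/\ vmem d omega2,
    cond_in d (E p.1 p.2) & vmem (eta p.1 p.2) d].
  have [b bo bE] := cond_in_exists (E p.1 p.2); have eo := etao p.1 p.2.
  have [||d dO dP] := @omega2_bounded [set b; eta p.1 p.2].
  - by move=> _ [->|->].
  - by apply: le1U; exact/countable_le1/countable1.
  exists d; split=> //; last by apply: dP; right.
  apply: cond_in_mono bE; first exact: omega2_ord.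
  by left; apply: dP; left.
have [||b bo bP] := @omega2_bounded (d @` ([set s | cond_in (osucc g) s] `*` elts (osucc g))).
- by move=> _ [p _ <-]; have [] := dP p.
- apply/le1_image/le1X; first exact: le1_cond_in.
  by have [_ _] := omega2P; apply.
exists b => // s x sg xg; have [d1 d2 d3] := dP (s, x).
have db : vmem (d (s, x)) b by apply: bP; exists (s, x).
have ob := omega2_ord bo; split; last exact: (ord_trans d3 db ob).
by apply: cond_in_mono d2 => //; left.
Qed.

Section Generic.
Variable b : V.
Hypothesis Lb : Lambda b.
Hypothesis hb : hull_closed pi Y (elts b).

Let bo : vmem b omega2. Proof. by case: Lb. Qed.
Let ob : ordinal b. Proof. exact: omega2_ord. Qed.
Let Cb : C b. Proof. exact: hull_closed_C. Qed.

Lemma cond_in_sub s K : cond_in b s -> Apart s K -> vsub K b.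
Proof.
move=> [_ s2] sK; have [i ib iK] := s2 K sK.
have XK := cond_X sK; have [Ko cK] := X_Pomega1 YP XK.
have bK : Sk (elts b) K.
  by rewrite -iK; apply/(Sk_pi Y pi_bij _ (omega2_trans ib bo)); exact: Sk_sub.
move=> x xK; have [_ <-] := Cb; split; last exact: Ko.
exact: (Sk_countable pi_bij (X_H YP XK) cK bK).
Qed.

Definition uncrossed (r : condition) :=
  forall x y, fpart r (x, y) -> vmem x b <-> vmem y b.

(* M and its trace on b together force the generic function not to cross b: a
   pair crossing b would have to lie in M, hence in its trace. *)
Lemma uncrossed_ext p : cond_in b p -> exists2 q, cond_le q p &
  forall r, cond_le r q -> uncrossed r.
Proof.
move=> pb; have [S [Sf So S1 S2 Sb]] := cond_support p.
have [||M XM SM] := @X_exists pi Y pi_bij (b |` S) Y_stationary.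
- by apply: countableU; [exact: countable1|exact: finite_set_countable].
- by move=> x [->//|/So].
have bM : vmem b M by apply: SM; left.
have {}SM x : S x -> vmem x M /\ vmem x b.
  by move=> Sx; split; [apply: SM; right|exact: (Sb b)].
have XN : X (vinter M b) by exact: X_inter.
set N := vinter M b in XN.
have NE x : vmem x N <-> vmem x M /\ vmem x b by exact: vinterE.
(* The code of [K] is in [M] and below [b], so [K] lies in the hulls of both [M] and [N]. *)
have pMN K : Apart p K -> adq K M /\ adq K N.
  move=> pK; have XK := cond_X pK; have [i Si iK] := S2 K pK; have [iM ib] := SM i Si.
  split; apply: adq_of_Sk => //; rewrite -iK;
    apply/(Sk_pi Y pi_bij _ (So _ Si)); apply: Sk_sub => //; exact/NE.
have MN : adq M N by exact: adq_inter_self.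
pose A := Apart p `|` [set M; N].
have finA : finite_set A by rewrite finite_setU; split; [exact: Apart_fin|exact: finite_set2].
have adqA : adequate pi Y Lambda A.
  split=> [K [/cond_X//|[->|->]]//|K L].
  move=> [pK|[->|->]] [pL|[->|->]]; rewrite -/(adq _ _).
  - exact: (cond_adq pK pL).
  - exact: (pMN K pK).1.
  - exact: (pMN K pK).2.
  - exact/adq_sym/(pMN L pL).1.
  - exact: adq_refl.
  - exact: MN.
  - exact/adq_sym/(pMN L pL).2.
  - exact: adq_sym.
  - exact: adq_refl.
have compA K x y : A K -> fpart p (x, y) -> elts K `&` ointerval x y !=set0 ->
    vmem x K /\ vmem y K.
  move=> [pK|[->|->]] pxy; first exact: (cond_compat pK pxy).
    by move=> _; have [/SM[xM _] /SM[yM _]] := S1 x y pxy.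
  by move=> _; have [/SM/NE xN /SM/NE yN] := S1 x y pxy.
exists (Condition (fpart_pfun p) finA adqA compA); first by split=> // K; left.
move=> r [/= Ar fr] x y rxy.
have [_ fo _] := fpart_pfun r; have [/= xo yo] := fo _ rxy.
have [oxx oyy] := (omega2_ord xo, omega2_ord yo).
have rM : Apart r M by apply: Ar; right; left.
have rN : Apart r N by apply: Ar; right; right.
(* If x < b <= y, then [b] witnesses that [M] meets the interval, so [x] is in [M] and thus in [N].
   Now [N] meets the interval at [x], which forces [y] into [N], below [b]. The other case is
   symmetric. *)
split=> [xb|yb]; apply: contrapT => nb.
  have by' : ole b y by exact: ord_leP.
  have [|xM _] := cond_compat rM rxy; first by exists b; split=> //; left; split=> //; left.
  have [|_ /NE[]//] := cond_compat rN rxy; exists x; split; first exact/NE.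
  by left; split; [right|left; exact: (lt_ole_trans xb by' oyy)].
have bx : ole b x by exact: ord_leP.
have [|_ yM] := cond_compat rM rxy; first by exists b; split=> //; right; split=> //; left.
have [|/NE[]//] := cond_compat rN rxy; exists y; split; first exact/NE.
by right; split; [right|left; exact: (lt_ole_trans yb bx oxx)].
Qed.

(* The trace of r on b; by thinness it lies in the hull of b. *)
Lemma restriction p r : cond_in b p -> cond_le r p -> uncrossed r ->
  exists r', [/\ cond_in b r', cond_le r' p &
    forall s, cond_in b s -> cond_le s r' -> exists2 t, cond_le t r & cond_le t s].
Proof.
move=> pb [Arp frp] ur.
pose f := fpart r `&` [set p | vmem p.1 b /\ vmem p.2 b].
pose A := (fun K => vinter K b) @` Apart r.
have [ff fo ffun] := fpart_pfun r.
have fP : finite_pfun f.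
  split; [exact: finite_setIl|by move=> x [/fo]|].
  by move=> x y y' [h _] [h' _]; exact: ffun h h'.
have Af : finite_set A by apply: finite_image; exact: Apart_fin.
have Aa : adequate pi Y Lambda A.
  split=> [_ [K /cond_X XK <-]|_ _ [K rK <-] [L rL <-]]; first exact: X_inter.
  apply: (adq_inter pi_bij YP) => //; [exact: (cond_X rK)|exact: (cond_X rL)|].
  exact: cond_adq rK rL.
have Ac K x y : A K -> f (x, y) -> elts K `&` ointerval x y !=set0 -> vmem x K /\ vmem y K.
  move=> [K' rK' <-] [/= rxy [xb yb]] [z [/vinterE[zK' zb] xzy]].
  have [|xK' yK'] := cond_compat rK' rxy; first by exists z.
  by split; apply/vinterE.
exists (Condition fP Af Aa Ac); split.
- split=> /= [x y [_ []]//|_ [K rK <-]].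
  apply: (C_Sk pi_bij Cb); apply: (Sk_Y_inter pi_bij YP) => //.
  by have [] := cond_X rK.
- split=> /= [K pK|[x y] pxy].
    by exists K; [exact: Arp|apply: vinter_id; exact: cond_in_sub pK].
  by split; [exact: frp|have [+ _] := pb; apply].
move=> s sb [/= As fs].
have [sf so sfun] := fpart_pfun s.
(* A pair of [r] with its first entry below [b] does not cross [b], so it belongs to the trace that
   [s] extends. *)
have rs x y : fpart r (x, y) -> vmem x b -> fpart s (x, y).
  by move=> rxy xb; apply: fs; split=> //; split=> //=; exact/(ur _ _ rxy).
have tP : finite_pfun (fpart r `|` fpart s).
  split; first by rewrite finite_setU.
    by move=> x [/fo|/so].
  have sx x y : fpart s (x, y) -> vmem x b by case: sb => + _ => /[apply] -[].
  move=> x y y' [h|h] [h'|h']; [exact: ffun h h'| | |exact: sfun h h'].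
    by apply: sfun (h'); apply: rs h (sx _ _ h').
  by apply: (sfun _ _ _ h); exact: rs h' (sx _ _ h).
have tf : finite_set (Apart r `|` Apart s) by rewrite finite_setU; split; exact: Apart_fin.
have rsa K L : Apart r K -> Apart s L -> adq K L.
  move=> rK sL; apply: (@adq_lift pi Y pi_bij YP K L b) => //.
  - exact: cond_X rK.
  - exact: cond_X sL.
  - exact: cond_in_sub sL.
  by apply: cond_adq sL; apply: As; exists K.
have ta : adequate pi Y Lambda (Apart r `|` Apart s).
  split=> [K [/cond_X//|/cond_X//]|K L [hK|hK] [hL|hL]]; rewrite -/(adq _ _).
  - exact: cond_adq hK hL.
  - exact: rsa.
  - exact/adq_sym/rsa.
  - exact: cond_adq hK hL.
have tc K x y : (Apart r `|` Apart s) K -> (fpart r `|` fpart s) (x, y) ->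
    elts K `&` ointerval x y !=set0 -> vmem x K /\ vmem y K.
  (* Mixed cases. A pair of [s] lies below [b], so a model of [r] meets its interval inside the
     trace of that model, which belongs to [s]. A model of [s] lies below [b], so a pair of [r]
     whose interval it meets has an end below [b]; uncrossed, the pair is in [s]. *)
  move=> [hK|hK] [hxy|hxy]; [exact: (cond_compat hK hxy)| | |exact: (cond_compat hK hxy)].
    have [xb yb] := sb.1 _ _ hxy.
    move=> [z [zK xzy]]; have zb : vmem z b.
      by case: xzy => -[_ h]; [exact: (ole_lt_trans h yb ob)|exact: (ole_lt_trans h xb ob)].
    have sK : Apart s (vinter K b) by apply: As; exists K.
    have [|/vinterE[xK _] /vinterE[yK _]//] := cond_compat sK hxy.
    by exists z; split=> //; exact/vinterE.
  move=> h; apply: (cond_compat hK _ h); apply: rs => //.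
  case: h => z [zK xzy]; have zb := cond_in_sub sb hK zK.
  case: xzy => -[h _]; first exact: (ole_lt_trans h zb ob).
  by apply/(ur _ _ hxy); exact: (ole_lt_trans h zb ob).
by exists (Condition tP tf ta tc); split=> K; [left|left|right|right].
Qed.

End Generic.
End Poset.

(** * The forcing relation *)

Section Forcing.
Variable P : forcing.
Implicit Types (p q r s : P) (x y z w h a : name P) (phi psi : fprop P).

Lemma f_eq_mono x y p q : le q p -> f_eq x y p -> f_eq x y q.
Proof.
case: x y => A f c [B g d] qp [h1 h2].
by split=> i r rq; [apply: h1|apply: h2]; exact: le_trans rq qp.
Qed.

Lemma f_not_mono phi p q : le q p -> f_not phi p -> f_not phi q.
Proof. by move=> qp np r rq; apply: np; exact: le_trans rq qp. Qed.

Lemma f_eq_refl x p : f_eq x x p.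
Proof.
elim: x p => A f IH c p; split=> i q _ qi r rq; exists r; try exact: le_refl;
  by exists i => //; exact: le_trans rq qi.
Qed.

Lemma f_eq_sym x y p : f_eq x y p -> f_eq y x p.
Proof.
elim: x y p => A f IH c [B g d] p [h1 h2].
split=> [j q qp qj r rq|i q qp qi r rq].
  have [r' r'r [i ri e]] := h2 j q qp qj r rq.
  by exists r' => //; exists i => //; exact: IH.
have [r' r'r [j rj e]] := h1 i q qp qi r rq.
by exists r' => //; exists j => //; exact: IH.
Qed.

Lemma f_eq_trans x y z p : f_eq x y p -> f_eq y z p -> f_eq x z p.
Proof.
elim: x y z p => A f IH c [B g d] [D e k] p [xy yx] [yz zy].
split=> [i q qp qi r rq|l q qp ql r rq].
  have [r1 r1r [j r1j e1]] := xy i q qp qi r rq.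
  have r1p := le_trans r1r (le_trans rq qp).
  have [r2 r21 [l r2l e2]] := yz j r1 r1p r1j r1 (le_refl r1).
  exists r2; first exact: le_trans r21 r1r.
  by exists l => //; exact: IH (f_eq_mono r21 e1) e2.
have [r1 r1r [j r1j e1]] := zy l q qp ql r rq.
have r1p := le_trans r1r (le_trans rq qp).
have [r2 r21 [i r2i e2]] := yx j r1 r1p r1j r1 (le_refl r1).
exists r2; first exact: le_trans r21 r1r.
by exists i => //; exact: IH e2 (f_eq_mono r21 e1).
Qed.

Lemma f_mem_eql x x' y p : f_eq x x' p -> f_mem x y p -> f_mem x' y p.
Proof.
case: y => B g d e h q qp; have [r rq [j rj xj]] := h q qp.
exists r => //; exists j => //; apply: f_eq_trans xj; apply: f_eq_sym.
exact: f_eq_mono (le_trans rq qp) e.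
Qed.

Lemma f_mem_eqr x y y' p : f_eq y y' p -> f_mem x y p -> f_mem x y' p.
Proof.
case: y y' => A f c [B g d] [h1 _] h q qp; have [r rq [i ri xi]] := h q qp.
have [r2 r2r [j rj ij]] := h1 i r (le_trans rq qp) ri r (le_refl r).
exists r2; first exact: le_trans r2r rq.
by exists j => //; exact: f_eq_trans (f_eq_mono r2r xi) ij.
Qed.

(** Check names carry only the condition [one], so the forced statement does not depend on [p]. *)
Lemma f_eq_check_tree t u p : f_eq (check_tree P t) (check_tree P u) p <-> bisim t u.
Proof.
elim: t u p => A f IH [B g] p /=; split=> -[h1 h2]; split.
- move=> i; have [r _ [j _ /IH]] := h1 i p (le_refl p) (le_one p) p (le_refl p).
  by exists j.
- move=> j; have [r _ [i _ /IH]] := h2 j p (le_refl p) (le_one p) p (le_refl p).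
  by exists i.
- move=> i q _ _ r _; exists r; first exact: le_refl.
  by have [j ij] := h1 i; exists j; [exact: le_one|exact/IH].
move=> j q _ _ r _; exists r; first exact: le_refl.
by have [i ij] := h2 j; exists i; [exact: le_one|exact/IH].
Qed.

Lemma f_eq_check u v p : f_eq (check P u) (check P v) p -> u = v.
Proof. by move=> /f_eq_check_tree /pi_bisim; rewrite !reprK. Qed.

Lemma f_mem_checkE x u p : f_mem x (check P u) p <->
  dense_below (fun r => exists2 v, vmem v u & f_eq x (check P v) r) p.
Proof.
have E i (r : P) : f_eq (check_tree P (@child (repr u) i))
    (check P (\pi_V (child i))) r.
  by apply/f_eq_check_tree; apply/pi_bisim; rewrite reprK.
rewrite /vmem /check in E *; case: (repr u) E => B g E /=.
split=> h q qp; have [r rq] := h q qp.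
  move=> [j _ e]; exists r => //; exists (\pi_V (g j)); first by exists j.
  exact: f_eq_trans e (E j r).
move=> [v [j ->] e]; exists r => //; exists j; first exact: le_one.
exact: f_eq_trans e (f_eq_sym (E j r)).
Qed.

Lemma f_mem_check u v p : vmem v u -> f_mem (check P v) (check P u) p.
Proof.
move=> vu; apply/f_mem_checkE => q _; exists q; first exact: le_refl.
by exists v => //; exact: f_eq_refl.
Qed.

Lemma f_exP (F : name P -> fprop P) p :
  f_ex F p <-> forall q, le q p -> exists x r, le r q /\ F x r.
Proof.
split=> h q qp; last by move=> n; have [x [r [rq Fx]]] := h q qp; exact: (n x r rq).
apply: contrapT => n; apply: (h q qp) => x r rq Fx; apply: n; by exists x, r.
Qed.

(** [psi] is only obtained at an extension of [q], because an arbitrary [fprop] need not hold at a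
    condition below which it holds densely. *)
Lemma f_impP phi psi p : f_imp phi psi p <->
  forall q, le q p -> phi q -> exists2 r, le r q & psi r.
Proof.
split=> h q qp.
  move=> phq; apply: contrapT => n; apply: (h q qp); split=> // r rq pr.
  by apply: n; exists r.
by move=> [phq n]; have [r rq] := h q qp phq; exact: n.
Qed.

(** Forcing statements are predicates without syntax, so substitution of equal names is proved
    connective by connective, as equivalence at all conditions below [p]. *)
Definition feqv p phi psi := forall q, le q p -> phi q <-> psi q.

Lemma feqv_not p phi psi : feqv p phi psi -> feqv p (f_not phi) (f_not psi).
Proof.
move=> e q qp; have e' r : le r q -> phi r <-> psi r.
  by move=> rq; apply: e; exact: le_trans rq qp.
by split=> h r rq /e' => /(_ rq); exact: h.
Qed.

Lemma feqv_and p phi psi phi' psi' : feqv p phi psi -> feqv p phi' psi' ->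
  feqv p (f_and phi phi') (f_and psi psi').
Proof.
move=> e e' q qp; have [e1 e2] := e q qp; have [e3 e4] := e' q qp.
by split=> -[h1 h2]; split; auto.
Qed.

Lemma feqv_all p (F G : name P -> fprop P) : (forall x, feqv p (F x) (G x)) ->
  feqv p (f_all F) (f_all G).
Proof. by move=> e q qp; split=> h x; have [e1 e2] := e x q qp; auto. Qed.

Lemma feqv_ex p (F G : name P -> fprop P) : (forall x, feqv p (F x) (G x)) ->
  feqv p (f_ex F) (f_ex G).
Proof. by move=> e; apply/feqv_not/feqv_all => x; exact: feqv_not. Qed.

Lemma feqv_upair p z x x' y y' : f_eq x x' p -> f_eq y y' p ->
  feqv p (f_upair z x y) (f_upair z x' y').
Proof.
have E u u' w : f_eq u u' p -> feqv p (f_eq w u) (f_eq w u').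
  move=> e q qp; have eq := f_eq_mono qp e.
  by split=> h; [exact: f_eq_trans h eq|exact: f_eq_trans h (f_eq_sym eq)].
move=> xx' yy'; apply: feqv_all => w.
have O : feqv p (f_or (f_eq w x) (f_eq w y)) (f_or (f_eq w x') (f_eq w y')).
  by apply/feqv_not/feqv_and; apply: feqv_not; exact: E.
by apply: feqv_and; apply/feqv_not/feqv_and => //; exact: feqv_not.
Qed.

Lemma feqv_app p h x x' y y' : f_eq x x' p -> f_eq y y' p ->
  feqv p (f_app h x y) (f_app h x' y').
Proof.
move=> xx' yy'; apply: feqv_ex => z; apply: feqv_and => //.
apply: feqv_ex => u; apply: feqv_ex => v; apply: feqv_and; first exact: feqv_upair.
by apply: feqv_and => //; exact: feqv_upair.
Qed.

(** [f_app] unfolds to an [f_not], and every negation is monotone. *)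
Lemma f_app_mono h x y p q : le q p -> f_app h x y p -> f_app h x y q.
Proof. exact: f_not_mono. Qed.

(** Stated for any name forced equal to a check name, since that is all that is known of an element
    of a check name. *)
Lemma f_transitive_check u z p : transitive_set u -> f_eq z (check P u) p ->
  f_transitive z p.
Proof.
move=> tu e y; apply/f_impP => q qp /(f_mem_eqr (f_eq_mono qp e)) /f_mem_checkE.
move=> /(_ q (le_refl q))[r rq [v vu yv]]; exists r => // x.
apply/f_impP => q' q'r /(f_mem_eqr (f_eq_mono q'r yv)) /f_mem_checkE.
move=> /(_ q' (le_refl q'))[r' r'q' [w wv xw]]; exists r' => //.
have r'p := le_trans r'q' (le_trans q'r (le_trans rq qp)).
apply: (f_mem_eqr (f_eq_sym (f_eq_mono r'p e))).
by apply: (f_mem_eql (f_eq_sym xw)); apply: f_mem_check; exact: tu wv.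
Qed.

Lemma f_ordinal_check u p : ordinal u -> f_ordinal (check P u) p.
Proof.
move=> [tu eu]; split; first by apply: (f_transitive_check tu); exact: f_eq_refl.
move=> x; apply/f_impP => q qp /f_mem_checkE /(_ q (le_refl q))[r rq [v vu xv]].
by exists r => //; exact: f_transitive_check (eu v vu) xv.
Qed.

Lemma f_bijection_check h a k u p : f_eq a (check P u) p ->
  f_bijection h a (check P k) p ->
  [/\ forall v q, vmem v u -> le q p -> exists r e,
        [/\ le r q, vmem e k & f_app h (check P v) (check P e) r],
      forall e q, vmem e k -> le q p -> exists r v,
        [/\ le r q, vmem v u & f_app h (check P v) (check P e) r] &
      forall x e e' q, le q p -> f_app h x (check P e) q ->
        f_app h x (check P e') q -> e = e'].
Proof.
move=> au [_ [tot [fn [_ surj]]]]; split.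
- move=> v q vu qp; have va : f_mem (check P v) a q.
    by apply: f_mem_eqr (f_eq_sym (f_eq_mono qp au)) _; exact: f_mem_check.
  have [r rq /f_exP] := (f_impP _ _ _).1 (tot (check P v)) q qp va.
  move=> /(_ r (le_refl r))[y [r2 [r2r [yk vy]]]].
  have [r3 r32 [e ek ye]] := (f_mem_checkE _ _ _).1 yk r2 (le_refl r2).
  exists r3, e; split=> //; first exact: le_trans r32 (le_trans r2r rq).
  by apply/(feqv_app _ (f_eq_refl _ _) ye (le_refl r3)); exact: f_app_mono vy.
- move=> e q ek qp; have ek' := f_mem_check q ek.
  have [r rq /f_exP] := (f_impP _ _ _).1 (surj (check P e)) q qp ek'.
  move=> /(_ r (le_refl r))[x [r2 [r2r [xa xe]]]].
  have r2p := le_trans r2r (le_trans rq qp).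
  have /f_mem_checkE := f_mem_eqr (f_eq_mono r2p au) xa.
  move=> /(_ r2 (le_refl r2))[r3 r32 [v vu xv]].
  exists r3, v; split=> //; first exact: le_trans r32 (le_trans r2r rq).
  by apply/(feqv_app _ xv (f_eq_refl _ _) (le_refl r3)); exact: f_app_mono xe.
move=> x e e' q qp xe xe'.
(* Some extension forces the two check names to be equal, and then the sets are equal outright. *)
have [r _ /f_eq_check//] :=
  (f_impP _ _ _).1 (fn x (check P e) (check P e')) q qp (conj xe xe').
Qed.

(* The hypotheses on h say that p forces it to map u onto k. *)
Lemma preserves_cardinalI k : ordinal k ->
  (forall u h p, vmem u k ->
    (forall v q, vmem v u -> le q p -> exists r e,
        [/\ le r q, vmem e k & f_app h (check P v) (check P e) r]) ->
    (forall e q, vmem e k -> le q p -> exists r v,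
        [/\ le r q, vmem v u & f_app h (check P v) (check P e) r]) ->
    (forall x e e' q, le q p -> f_app h x (check P e) q ->
        f_app h x (check P e') q -> e = e') -> False) ->
  preserves_cardinal P k.
Proof.
move=> ok H p; split; first exact: f_ordinal_check.
move=> a; apply/f_impP => q qp /f_mem_checkE /(_ q (le_refl q))[r rq [u uk au]].
exists r => // s sr /f_exP /(_ s (le_refl s))[h [t [ts bij]]].
have [h1 h2 h3] := f_bijection_check (f_eq_mono (le_trans ts sr) au) bij.
exact: H uk h1 h2 h3.
Qed.

End Forcing.

(** * Refuting a forced surjection onto omega_2 *)

Theorem proposition5p3
  (pow_omega1 : vpow omega1 #= elts omega2)
  (pi : V -> V) (pi_bij : set_bij (elts omega2) H_omega2 pi)
  (Y : set V) (Y_stationary : stationary_P Y) (Y_thin : thin Y)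
  (Y_initial : initial_closed Y) :
  preserves_cardinal (PP pi Y) omega2.
Proof.
apply: preserves_cardinalI => [|a h p ao tot surj fn]; first exact: ord_omega2.
(* [F] picks an extension deciding [h] at [x], together with the value. The default [(s, empty)]
   keeps it total with values below omega_2, as [cond_in_bound] demands. *)
have /choice[F FP] (sx : condition pi Y * V) : exists te : condition pi Y * V,
    vmem te.2 omega2 /\ (vmem sx.2 a -> cond_le sx.1 p -> cond_le te.1 sx.1 /\
      f_app h (check (PP pi Y) sx.2) (check (PP pi Y) te.2) te.1).
  case: sx => s x; case: (pselect (vmem x a /\ cond_le s p)) => [[xa sp]|n]; last first.
    by exists (s, empty); split=> [|xa sp]; [exact: omega2_gt0|case: n].
  have [r [e [rs eo hr]]] := tot x s xa sp.
  by exists (r, e).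
have [b0 b0o pb0] := cond_in_exists pi_bij Y_stationary p.
have [||g go gP] := @omega2_bounded [set b0; a].
- by move=> _ [->|->].
- by apply: le1U; exact/countable_le1/countable1.
have bound := @cond_in_bound pi Y pi_bij Y_stationary (fun s x => (F (s, x)).1)
  (fun s x => (F (s, x)).2) (fun s x => (FP (s, x)).1).
have [b [Lb gb hb cl]] := @Lambda_reflect pi Y pi_bij _ bound _ go.
have bo : vmem b omega2 by case: Lb.
have ob := omega2_ord bo.
have pb : cond_in b p.
  apply: cond_in_mono pb0 => //; left; apply: (ord_trans _ gb ob); apply: gP; by left.
have ab : vmem a b by apply: (ord_trans _ gb ob); apply: gP; right.
have [q qp qu] := uncrossed_ext pi_bij Y_stationary Y_initial Lb hb pb.
have [r [x [rq xa hr]]] := surj b q bo qp.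
have [r' [r'b r'p r'c]] := restriction pi_bij Y_stationary Y_thin Y_initial Lb hb pb
  (cond_le_trans rq qp) (qu r rq).
(* [r'] and [x] already live below [osucc c] for some [c] in [b], so closure of [b] puts the value
   decided by [F] at this pair below some [d] in [b]. *)
have [c [cb r'cc xc]] := cond_in_local pi_bij Y_stationary Lb r'b (ord_trans xa ab ob).
have [d db /(_ r' x r'cc xc)[Ed ed]] := cl c cb.
have [_ /= /(_ xa r'p)[Er' hE]] := FP (r', x).
have [|t tr tE] := r'c (F (r', x)).1 _ Er'; first by apply: cond_in_mono Ed => //; left.
have tp := cond_le_trans tr (cond_le_trans rq qp).
(* [t] is below [r], which sends [x] to [b], and below the extension chosen by [F], which sends [x]
   under [d]; functionality makes [b] an element of [d]. *)
have e := fn _ _ _ t tp (@f_app_mono (PP pi Y) _ _ _ _ t tr hr)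
  (@f_app_mono (PP pi Y) _ _ _ _ t tE hE).
by rewrite -e in ed; exact: (vmem_asym ed db).
Qed.
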